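(* Let $K\subset\mathbb{C}$ be a convex domain with positive depth $h_K>0$ and diameter $d$, and let $1\le q<\infty$. Then for every $n\in\mathbb{N}$ and every $p\in\mathcal{P}_n(K)$, $$\|p'\|_{L^q(\partial K)}\ge \frac{h_K^4}{3000\, d^5}\, n\, \|p\|_{L^q(\partial K)}.$$
   Context: A convex domain is a compact convex subset $K\subset\mathbb{C}$ with nonempty interior; $d=\max_{z,z'\in K}|z-z'|$. A unit vector $\nu\in\mathbb{C}$ is an outer normal to $K$ at $\zeta\in\partial K$ if $\mathrm{Re}((z-\zeta)\overline{\nu})\le 0$ for all $z\in K$; then $(\zeta+\nu\mathbb{R})\cap K=[\zeta,\zeta-h\nu]$ for some $h\ge 0$. The local depth $h_K(\zeta)$ is the maximum of these lengths $h$ over all outer unit normals $\nu$ at $\zeta$, and the depth of $K$ is $h_K:=\inf_{\zeta\in\partial K}h_K(\zeta)$. $\|f\|_{L^q(\partial K)}=\left(\int_{\partial K}|f(z)|^q|dz|\right)^{1/q}$ with arc length measure. $\mathcal{P}_n(K)$ is the set of complex polynomials of degree exactly $n$ with all zeros in $K$. *)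

(* Defs.v *)
From Stdlib Require Import Reals Lra.
Open Scope R_scope.

Definition Cx : Type := (R * R)%type.
Definition Cmk (x y : R) : Cx := (x, y).
Definition Cre (z : Cx) : R := fst z.
Definition Cim (z : Cx) : R := snd z.
Definition C0 : Cx := (0, 0).
Definition C1 : Cx := (1, 0).
Definition Cadd (z w : Cx) : Cx := (fst z + fst w, snd z + snd w).
Definition Copp (z : Cx) : Cx := (- fst z, - snd z).
Definition Csub (z w : Cx) : Cx := Cadd z (Copp w).
Definition Cmul (z w : Cx) : Cx :=
  (fst z * fst w - snd z * snd w, fst z * snd w + snd z * fst w).
Definition Cscal (t : R) (z : Cx) : Cx := (t * fst z, t * snd z).
Definition Cconj (z : Cx) : Cx := (fst z, - snd z).
Definition Cmod (z : Cx) : R := sqrt (fst z * fst z + snd z * snd z).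
Fixpoint Cpow (z : Cx) (k : nat) : Cx :=
  match k with O => C1 | S k' => Cmul z (Cpow z k') end.

Fixpoint rsum (f : nat -> R) (m : nat) : R :=
  match m with O => 0 | S m' => rsum f m' + f m' end.
Fixpoint csum (f : nat -> Cx) (m : nat) : Cx :=
  match m with O => C0 | S m' => Cadd (csum f m') (f m') end.

(* x ^ y for x >= 0, y > 0, with 0 ^ y = 0 *)
Definition rpow (x y : R) : R :=
  if Rle_dec x 0 then 0 else Rpower x y.

Definition psum (a : nat -> Cx) (m : nat) (z : Cx) : Cx :=
  csum (fun k => Cmul (a k) (Cpow z k)) m.
Definition peval (a : nat -> Cx) (n : nat) (z : Cx) : Cx := psum a (S n) z.
Definition pderiv (a : nat -> Cx) (k : nat) : Cx := Cscal (INR (S k)) (a (S k)).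
Definition peval_deriv (a : nat -> Cx) (n : nat) (z : Cx) : Cx := psum (pderiv a) n z.

Definition in_Pn (K : Cx -> Prop) (n : nat) (a : nat -> Cx) : Prop :=
  a n <> C0 /\ (forall z, peval a n z = C0 -> K z).

Definition convex (K : Cx -> Prop) : Prop :=
  forall z w t, K z -> K w -> 0 <= t <= 1 ->
    K (Cadd (Cscal (1 - t) z) (Cscal t w)).
Definition closed (K : Cx -> Prop) : Prop :=
  forall z, (forall eps, 0 < eps -> exists w, K w /\ Cmod (Csub w z) < eps) -> K z.
Definition bounded (K : Cx -> Prop) : Prop :=
  exists M, forall z, K z -> Cmod z <= M.
Definition interior_point (K : Cx -> Prop) (z : Cx) : Prop :=
  exists r, 0 < r /\ forall w, Cmod (Csub w z) < r -> K w.
Definition convex_domain (K : Cx -> Prop) : Prop :=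
  convex K /\ closed K /\ bounded K /\ exists z, interior_point K z.

(* boundary point (K closed) *)
Definition boundary (K : Cx -> Prop) (z : Cx) : Prop :=
  K z /\ forall eps, 0 < eps -> exists w, ~ K w /\ Cmod (Csub w z) < eps.

Definition diameter (K : Cx -> Prop) (d : R) : Prop :=
  (forall z w, K z -> K w -> Cmod (Csub z w) <= d) /\
  (exists z w, K z /\ K w /\ Cmod (Csub z w) = d).

Definition outer_normal (K : Cx -> Prop) (zeta nu : Cx) : Prop :=
  boundary K zeta /\ Cmod nu = 1 /\
  forall z, K z -> Cre (Cmul (Csub z zeta) (Cconj nu)) <= 0.

Definition normal_chord (K : Cx -> Prop) (zeta nu : Cx) (h : R) : Prop :=
  0 <= h /\ forall t : R, K (Cadd zeta (Cscal t nu)) <-> (- h <= t <= 0).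

Definition is_glb (E : R -> Prop) (m : R) : Prop :=
  (forall x, E x -> m <= x) /\ (forall b, (forall x, E x -> b <= x) -> b <= m).

Definition local_depth (K : Cx -> Prop) (zeta : Cx) (r : R) : Prop :=
  is_lub (fun h => exists nu, outer_normal K zeta nu /\ normal_chord K zeta nu h) r.

Definition depth (K : Cx -> Prop) (hK : R) : Prop :=
  is_glb (fun r => exists zeta, boundary K zeta /\ local_depth K zeta r) hK.

Definition boundary_param (K : Cx -> Prop) (gamma : R -> Cx) : Prop :=
  (forall t, 0 <= t <= 1 -> forall eps, 0 < eps -> exists del, 0 < del /\
     forall s, 0 <= s <= 1 -> Rabs (s - t) < del ->
       Cmod (Csub (gamma s) (gamma t)) < eps) /\
  gamma 0 = gamma 1 /\
  (forall s t, 0 <= s < 1 -> 0 <= t < 1 -> gamma s = gamma t -> s = t) /\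
  (forall t, 0 <= t <= 1 -> boundary K (gamma t)) /\
  (forall z, boundary K z -> exists t, 0 <= t <= 1 /\ gamma t = z).

Definition fine_partition (t : nat -> R) (m : nat) (del : R) : Prop :=
  t O = 0 /\ t m = 1 /\
  forall k, (k < m)%nat -> t k < t (S k) /\ t (S k) - t k < del.

Definition arc_integral (gamma : R -> Cx) (g : Cx -> R) (I : R) : Prop :=
  forall eps, 0 < eps -> exists del, 0 < del /\
    forall t m, fine_partition t m del ->
      Rabs (rsum (fun k => g (gamma (t k)) *
                  Cmod (Csub (gamma (t (S k))) (gamma (t k)))) m - I) < eps.

(* Main.v *)
(* Factor p = A prod (z - z_k) and let zeta be a boundary point with inner normal chord of
   length h close to h_K. With v_k = nu / (zeta - z_k) one has p'/p = conj(nu) sum v_k, Re v_k >= 0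
   and p(zeta - t nu) / p(zeta) = prod (1 - t v_k). If |p'(zeta)| < c n |p(zeta)|, then sum Re v_k
   is small, so most factors |1 - t v_k| exceed 1 by a fixed amount for t in [h/2, h], while the
   product of the few others is controlled at a suitable t by finite differences: |p| is
   exponentially larger at an interior point than at zeta. On the other hand the maximum of |p|
   over K is at most the total variation of p along the boundary, since p has a zero in K and the
   maximum principle applies to p - p(gamma 0); so these points zeta contribute to the
   norm of p at most e^{-c'n} times a multiple of the norm of p'. The length of the boundary
   is at most 6 d, because a coordinate takes no value strictly between its extremes more than
   twice on the boundary of a convex set. *)

From mathcomp Require all_boot all_order all_algebra complex Rstruct.
From Coquelicot Require Compactness.
From Stdlib Require Import Reals Lra Lia List Factorial Classical ClassicalEpsilon.
Require Import Defs.
Open Scope R_scope.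

(** The exponent 4 comes from a balance. Put x = h/d. A factor with Re v_k <= x/(8d) gains
    e^{x^2/18} for every t in [h/2, h]. The exceptional factors admit no pointwise bound, since 1 -
    t v_k may vanish; hence t is chosen for all of them at once, and their product is then at least
    x/12 >= e^{-5/x} per factor. To keep half of the gain, the exceptional factors may form only a
    fraction of order x^3, and Markov's inequality at the threshold x/(8d) turns this into a sum of
    Re v_k of order n x^4/d. The constant does not depend on q. With [lam] a bound for the L^q mean
    of p' over a curve of length 6d, |p| is at most |p'|/c where p' is large and at most e^{-y} 12 d
    [lam] elsewhere. Superadditivity of t^q adds these two bounds, and the length 6d occurs on both
    sides and cancels. Of the exponential decay only e^{-y} <= 1/y is used in the end; it supplies
    the factor 1/n. *)

(** * Products of linear factors and the factorization of polynomials *)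

Fixpoint root_prod (zs : list Cx) (z : Cx) : Cx :=
  match zs with
  | nil => C1
  | w :: l => Cmul (Csub z w) (root_prod l z)
  end.

Fixpoint root_prod_deriv (zs : list Cx) (z : Cx) : Cx :=
  match zs with
  | nil => C0
  | w :: l => Cadd (root_prod l z) (Cmul (Csub z w) (root_prod_deriv l z))
  end.

(** The module keeps the MathComp notations local. It exists for [factorization]: coefficients go to
    the algebraically closed field [R[i]] and the roots come back, so that a polynomial and its
    derivative are expressed through one list of roots. *)
Module FundamentalTheorem.
Import all_boot all_order all_algebra complex Rstruct.
Import GRing.Theory.

Definition toC (z : Cx) : R[i] := Complex (fst z) (snd z).
Definition ofC (z : R[i]) : Cx := (Re z, Im z).

Lemma ofCK z : toC (ofC z) = z. Proof. by case: z. Qed.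
Lemma toCK z : ofC (toC z) = z. Proof. by case: z. Qed.

Lemma toC_add z w : toC (Cadd z w) = (toC z + toC w)%R.
Proof. by []. Qed.

Lemma toC_mul z w : toC (Cmul z w) = (toC z * toC w)%R.
Proof. by []. Qed.

Lemma toC_sub z w : toC (Csub z w) = (toC z - toC w)%R.
Proof. by []. Qed.

Lemma toC_pow z k : toC (Cpow z k) = (toC z ^+ k)%R.
Proof.
elim: k => [|k IH] //.
by rewrite exprS -IH -toC_mul.
Qed.

Lemma toC_sum f m : toC (csum f m) = (\sum_(i < m) toC (f i))%R.
Proof.
elim: m => [|m IH]; first by rewrite big_ord0.
by rewrite big_ord_recr /= -IH -toC_add.
Qed.

Lemma toC_scal k z : toC (Cscal (INR k) z) = (toC z *+ k)%R.
Proof.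
elim: k => [|k IH].
  by case: z => x y; rewrite /toC /Cscal /= !Rmult_0_l.
rewrite mulrS -IH -toC_add; congr toC.
case: z {IH} => x y; rewrite /Cscal /Cadd S_INR; cbn [fst snd]; congr pair; ring.
Qed.

Definition topoly (a : nat -> Cx) (n : nat) : {poly R[i]} :=
  (\poly_(i < n.+1) toC (a i))%R.

Lemma topoly_horner a n z : ((topoly a n).[toC z])%R = toC (peval a n z).
Proof.
rewrite /topoly horner_poly /peval /psum toC_sum.
by apply: eq_bigr => i _; rewrite toC_mul toC_pow.
Qed.

Lemma topoly_deriv_horner a n z :
  (((topoly a n)^`()).[toC z])%R = toC (peval_deriv a n z).
Proof.
have -> : ((topoly a n)^`() = \poly_(i < n) toC (pderiv a i))%R.
  apply/polyP=> i; rewrite coef_deriv /topoly !coef_poly ltnS.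
  by case: ltnP => // _; [rewrite -toC_scal | rewrite mul0rn].
rewrite horner_poly /peval_deriv /psum toC_sum.
by apply: eq_bigr => i _; rewrite toC_mul toC_pow.
Qed.

Lemma root_prod_horner (r : seq R[i]) z :
  ((\prod_(w <- r) ('X - w%:P)).[toC z] = toC (root_prod (map ofC r) z))%R
  /\ ((\prod_(w <- r) ('X - w%:P))^`().[toC z] =
      toC (root_prod_deriv (map ofC r) z))%R.
Proof.
elim: r => [|w r [IH1 IH2]].
  by rewrite big_nil /= hornerC derivC horner0.
rewrite big_cons derivM derivXsubC mul1r hornerD !hornerM hornerXsubC IH1 IH2.
by cbn; rewrite ?toC_add !toC_mul toC_sub ofCK.
Qed.

Lemma factorization n a : a n <> C0 ->
  exists zs : list Cx, length zs = n /\
    forall z, peval a n z = Cmul (a n) (root_prod zs z) /\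
              peval_deriv a n z = Cmul (a n) (root_prod_deriv zs z).
Proof.
move=> an0.
have lead0 : toC (a n) != 0%R.
  apply/eqP => e; apply: an0; rewrite -[LHS]toCK e.
  by [].
have [r pE] := closed_field_poly_normal (topoly a n).
have leadE : lead_coef (topoly a n) = toC (a n) by exact: lead_coef_poly.
have sizeE : size (topoly a n) = n.+1 by exact: size_poly_eq.
exists (map ofC r); split.
  have := sizeE; rewrite pE leadE size_scale // size_prod_XsubC => -[<-].
  by elim: (r) => //= ? ? ->.
move=> z; have [E1 E2] := root_prod_horner r z; split.
  by rewrite -[LHS]toCK -topoly_horner pE leadE hornerZ E1 -toC_mul toCK.
by rewrite -[LHS]toCK -topoly_deriv_horner pE leadE derivZ hornerZ E2 -toC_mul toCK.
Qed.
End FundamentalTheorem.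

(** * Complex arithmetic, smoothness of polynomials, real powers *)

Lemma Cx_ring_theory : ring_theory C0 C1 Cadd Cmul Csub Copp eq.
Proof.
  split; intros; unfold Csub, Cadd, Cmul, Copp, C0, C1; cbn [fst snd];
    try destruct x; try destruct y; try destruct z; cbn [fst snd];
    try reflexivity; f_equal; ring.
Qed.
Add Ring Cx_ring : Cx_ring_theory.

Lemma Cmod_ge0 z : 0 <= Cmod z.
Proof. apply sqrt_pos. Qed.

Lemma Cmod_sqr z : Cmod z * Cmod z = fst z * fst z + snd z * snd z.
Proof. apply sqrt_sqrt; nra. Qed.

Lemma Cmod_mul z w : Cmod (Cmul z w) = Cmod z * Cmod w.
Proof.
  unfold Cmod at 2 3; rewrite <- sqrt_mult by nra.
  unfold Cmod, Cmul; f_equal; cbn [fst snd]; ring.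
Qed.

Lemma Cmod_conj z : Cmod (Cconj z) = Cmod z.
Proof. unfold Cmod, Cconj; f_equal; cbn [fst snd]; ring. Qed.

Lemma Cmod_scal t z : Cmod (Cscal t z) = Rabs t * Cmod z.
Proof.
  rewrite <- sqrt_Rsqr_abs; unfold Cmod; rewrite <- sqrt_mult;
    try apply Rle_0_sqr; [|nra].
  f_equal; unfold Rsqr, Cscal; cbn [fst snd]; ring.
Qed.

Lemma Rle_of_sqr x y : 0 <= y -> x * x <= y * y -> x <= y.
Proof. nra. Qed.

Lemma Rabs_bound x y : Rabs x <= y -> - y <= x <= y.
Proof. unfold Rabs; destruct (Rcase_abs x); lra. Qed.

Lemma Rle_plus_epsilon x y : (forall e, 0 < e -> x <= y + e) -> x <= y.
Proof.
  intros H; destruct (Rle_lt_dec x y) as [h|h]; [easy|].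
  specialize (H ((x - y) / 2) ltac:(lra)); lra.
Qed.

Lemma Cmod_triangle z w : Cmod (Cadd z w) <= Cmod z + Cmod w.
Proof.
  pose proof (Cmod_ge0 z); pose proof (Cmod_ge0 w).
  pose proof (Cmod_sqr z) as Hz; pose proof (Cmod_sqr w) as Hw.
  apply Rle_of_sqr; [lra|].
  rewrite Cmod_sqr; unfold Cadd; cbn [fst snd].
  assert (fst z * fst w + snd z * snd w <= Cmod z * Cmod w); [|nra].
  apply Rle_of_sqr; [nra|].
  replace (Cmod z * Cmod w * (Cmod z * Cmod w)) with
    ((Cmod z * Cmod z) * (Cmod w * Cmod w)) by ring.
  rewrite Hz, Hw.
  pose proof (Rle_0_sqr (fst z * snd w - snd z * fst w)); unfold Rsqr in *; nra.
Qed.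

Lemma Cmod_0 : Cmod C0 = 0.
Proof. unfold Cmod, C0; cbn [fst snd]; rewrite Rmult_0_l, Rplus_0_l; apply sqrt_0. Qed.

Lemma Cmod_1 : Cmod C1 = 1.
Proof.
  unfold Cmod, C1; cbn [fst snd]; rewrite Rmult_0_l, Rplus_0_r, Rmult_1_l; apply sqrt_1.
Qed.

Lemma Cmod_eq0 z : Cmod z = 0 -> z = C0.
Proof.
  intros H; pose proof (Cmod_sqr z) as E; rewrite H in E.
  destruct z as [x y]; cbn [fst snd] in E; unfold C0; f_equal; nra.
Qed.

Lemma Cmod_opp z : Cmod (Copp z) = Cmod z.
Proof. unfold Cmod, Copp; f_equal; cbn [fst snd]; ring. Qed.

Lemma Cmod_sub_sym z w : Cmod (Csub z w) = Cmod (Csub w z).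
Proof. rewrite <- Cmod_opp; f_equal; ring. Qed.

Lemma Cmod_sub_self z : Cmod (Csub z z) = 0.
Proof. replace (Csub z z) with C0 by ring; apply Cmod_0. Qed.

Lemma Cmod_sub_triangle x y z :
  Cmod (Csub x z) <= Cmod (Csub x y) + Cmod (Csub y z).
Proof.
  replace (Csub x z) with (Cadd (Csub x y) (Csub y z)) by ring; apply Cmod_triangle.
Qed.

Lemma Cmod_le_add z w : Cmod z <= Cmod w + Cmod (Csub z w).
Proof.
  replace z with (Cadd w (Csub z w)) at 1 by ring; apply Cmod_triangle.
Qed.

Lemma Cmod_le_abs z : Cmod z <= Rabs (fst z) + Rabs (snd z).
Proof.
  pose proof (Rabs_pos (fst z)); pose proof (Rabs_pos (snd z)).
  apply Rle_of_sqr; [lra|]; rewrite Cmod_sqr.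
  assert (forall t, t * t = Rabs t * Rabs t) as E.
  { intros t; rewrite <- Rabs_mult; symmetry; apply Rabs_pos_eq; nra. }
  rewrite (E (fst z)), (E (snd z)); nra.
Qed.

Lemma abs_fst_le_Cmod z : Rabs (fst z) <= Cmod z.
Proof.
  pose proof (Cmod_sqr z); pose proof (Cmod_ge0 z).
  apply Rabs_le; split; nra.
Qed.

Lemma abs_snd_le_Cmod z : Rabs (snd z) <= Cmod z.
Proof.
  pose proof (Cmod_sqr z); pose proof (Cmod_ge0 z).
  apply Rabs_le; split; nra.
Qed.

Lemma root_prod_eq0 zs z : In z zs -> root_prod zs z = C0.
Proof.
  induction zs as [|w l IH]; cbn; [easy|].
  intros [->|H]; [|rewrite (IH H)]; ring.
Qed.

(** The three estimates go through one induction with a common [B]: for an added factor, the bound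
    on values feeds the Lipschitz bound, which feeds the second order bound. *)
Lemma root_prod_smooth zs r : 0 <= r ->
  exists B, 0 <= B /\ forall z w, Cmod z <= r -> Cmod w <= r ->
    Cmod (root_prod zs z) <= B /\
    Cmod (Csub (root_prod zs w) (root_prod zs z)) <= B * Cmod (Csub w z) /\
    Cmod (Csub (Csub (root_prod zs w) (root_prod zs z))
               (Cmul (Csub w z) (root_prod_deriv zs z)))
      <= B * (Cmod (Csub w z) * Cmod (Csub w z)).
Proof.
  intros Hr; induction zs as [|a l [B [HB IH]]].
  - exists 1; split; [lra|]; intros z w _ _; cbn.
    replace (Csub C1 C1) with C0 by ring.
    replace (Csub C0 (Cmul (Csub w z) C0)) with C0 by ring.
    rewrite Cmod_0, Cmod_1; pose proof (Cmod_ge0 (Csub w z)); nra.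
  - exists ((r + Cmod a) * B + B); pose proof (Cmod_ge0 a).
    assert (0 <= (r + Cmod a) * B) by (apply Rmult_le_pos; lra).
    split; [lra|]; intros z w Hz Hw.
    destruct (IH z w Hz Hw) as [H1 [H2 H3]]; cbn.
    set (P := root_prod l) in *; set (D := root_prod_deriv l) in *.
    pose proof (Cmod_ge0 (Csub w z)) as Hu; set (u := Cmod (Csub w z)) in *.
    assert (Cmod (Csub z a) <= r + Cmod a) as Ha.
    { eapply Rle_trans; [apply Cmod_triangle|]; rewrite Cmod_opp; lra. }
    pose proof (Cmod_ge0 (Csub z a)).
    split; [|split].
    + rewrite Cmod_mul; pose proof (Cmod_ge0 (P z)).
      assert (Cmod (Csub z a) * Cmod (P z) <= (r + Cmod a) * B)
        by (apply Rmult_le_compat; lra); lra.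
    + destruct (IH w z Hw Hz) as [H1' _]; fold P in H1'.
      replace (Csub (Cmul (Csub w a) (P w)) (Cmul (Csub z a) (P z))) with
        (Cadd (Cmul (Csub z a) (Csub (P w) (P z))) (Cmul (Csub w z) (P w))) by ring.
      eapply Rle_trans; [apply Cmod_triangle|]; rewrite !Cmod_mul; fold u.
      pose proof (Cmod_ge0 (Csub (P w) (P z))).
      assert (Cmod (Csub z a) * Cmod (Csub (P w) (P z)) <= (r + Cmod a) * (B * u))
        by (apply Rmult_le_compat; lra).
      assert (u * Cmod (P w) <= u * B) by (apply Rmult_le_compat_l; lra).
      lra.
    + replace (Csub (Csub (Cmul (Csub w a) (P w)) (Cmul (Csub z a) (P z)))
                 (Cmul (Csub w z) (Cadd (P z) (Cmul (Csub z a) (D z))))) with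
        (Cadd (Cmul (Csub z a) (Csub (Csub (P w) (P z)) (Cmul (Csub w z) (D z))))
              (Cmul (Csub w z) (Csub (P w) (P z)))) by ring.
      eapply Rle_trans; [apply Cmod_triangle|]; rewrite !Cmod_mul; fold u.
      set (X := Csub (Csub (P w) (P z)) (Cmul (Csub w z) (D z))) in *.
      pose proof (Cmod_ge0 X).
      assert (Cmod (Csub z a) * Cmod X <= (r + Cmod a) * (B * (u * u)))
        by (apply Rmult_le_compat; lra).
      assert (u * Cmod (Csub (P w) (P z)) <= u * (B * u))
        by (apply Rmult_le_compat_l; lra).
      lra.
Qed.

(** The order of the error matters for [no_interior_max]: a cubic error is beaten by the gain eps
    s^2 once s is small. *)
Lemma root_prod_taylor2 zs z :
  exists c1 c2 B, 0 <= B /\ forall u, Cmod u <= 1 ->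
    Cmod (Csub (root_prod zs (Cadd z u))
       (Cadd (root_prod zs z) (Cadd (Cmul c1 u) (Cmul c2 (Cmul u u)))))
    <= B * (Cmod u * Cmod u * Cmod u).
Proof.
  induction zs as [|a l [c1 [c2 [B [HB IH]]]]].
  - exists C0, C0, 0; split; [lra|]; intros u _; cbn.
    replace (Csub _ _) with C0 by ring; rewrite Cmod_0; lra.
  - set (k := Csub z a); set (P := root_prod l) in *.
    exists (Cadd (P z) (Cmul k c1)), (Cadd c1 (Cmul k c2)).
    exists ((Cmod k + 1) * B + Cmod c2).
    pose proof (Cmod_ge0 k); pose proof (Cmod_ge0 c2).
    split; [nra|]; intros u Hu; specialize (IH u Hu); cbn; fold P.
    set (X := Csub (P (Cadd z u)) _) in IH.
    replace (Csub _ _) with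
      (Cadd (Cmul (Cadd k u) X) (Cmul c2 (Cmul u (Cmul u u))))
      by (unfold X, k; ring).
    eapply Rle_trans; [apply Cmod_triangle|]; rewrite !Cmod_mul.
    pose proof (Cmod_triangle k u); pose proof (Cmod_ge0 (Cadd k u));
      pose proof (Cmod_ge0 X).
    assert (Cmod (Cadd k u) * Cmod X <= (Cmod k + 1) * (B * (Cmod u * Cmod u * Cmod u)))
      by (apply Rmult_le_compat; lra).
    lra.
Qed.

Lemma rpow_ge0 x y : 0 <= rpow x y.
Proof. unfold rpow; destruct (Rle_dec x 0); [lra|]; left; apply exp_pos. Qed.

Lemma rpow_nonpos x y : x <= 0 -> rpow x y = 0.
Proof. intros H; unfold rpow; destruct (Rle_dec x 0); lra. Qed.

Lemma rpow_Rpower x y : 0 < x -> rpow x y = Rpower x y.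
Proof. intros H; unfold rpow; destruct (Rle_dec x 0); [lra|reflexivity]. Qed.

Lemma rpow_gt0 x y : 0 < x -> 0 < rpow x y.
Proof. intros H; rewrite rpow_Rpower by easy; apply exp_pos. Qed.

Lemma rpow_le x y q : 0 <= q -> x <= y -> rpow x q <= rpow y q.
Proof.
  intros Hq Hxy; destruct (Rle_dec x 0).
  - rewrite rpow_nonpos by easy; apply rpow_ge0.
  - rewrite !rpow_Rpower by lra; apply Rle_Rpower_l; lra.
Qed.

Lemma rpow_mult x y q : 0 <= x -> 0 <= y -> rpow (x * y) q = rpow x q * rpow y q.
Proof.
  intros Hx Hy; destruct (Req_dec x 0) as [->|Nx].
  { rewrite Rmult_0_l, rpow_nonpos by lra; ring. }
  destruct (Req_dec y 0) as [->|Ny].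
  { rewrite Rmult_0_r, (rpow_nonpos 0) by lra; ring. }
  rewrite !rpow_Rpower by nra; symmetry; apply Rpower_mult_distr; lra.
Qed.

Lemma rpow_inv x q : 0 <= x -> q <> 0 -> rpow (rpow x q) (1 / q) = x.
Proof.
  intros Hx Hq; destruct (Req_dec x 0) as [->|N].
  { rewrite (rpow_nonpos 0 q) by lra; apply rpow_nonpos; lra. }
  rewrite rpow_Rpower by (apply rpow_gt0; lra).
  rewrite rpow_Rpower, Rpower_mult by lra.
  replace (q * (1 / q)) with 1 by (field; easy); apply Rpower_1; lra.
Qed.

Lemma rpow_inv' x q : 0 <= x -> q <> 0 -> rpow (rpow x (1 / q)) q = x.
Proof.
  intros Hx Hq.
  replace q with (1 / (1 / q)) at 2 by (field; easy).
  apply rpow_inv; [easy|].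
  unfold Rdiv; rewrite Rmult_1_l; apply Rinv_neq_0_compat; easy.
Qed.

(** Write u^q = u e^{(q-1) ln u} and use e^x >= 1 + x twice, the second time in the form ln u >= 1 -
    1/u. *)
Lemma rpow_bernoulli u q : 0 <= u -> 1 <= q -> 1 + q * (u - 1) <= rpow u q.
Proof.
  intros Hu Hq; destruct (Req_dec u 0) as [->|N].
  { rewrite rpow_nonpos by lra; lra. }
  assert (0 < u) by lra; rewrite rpow_Rpower by easy.
  replace q with (1 + (q - 1)) at 2 by ring; rewrite Rpower_plus, Rpower_1 by easy.
  unfold Rpower; pose proof (exp_ineq1_le ((q - 1) * ln u)).
  assert (1 - / u <= ln u).
  { pose proof (exp_ineq1_le (- ln u)) as E; rewrite exp_Ropp, exp_ln in E; lra. }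
  assert (u * / u = 1) by (field; lra).
  assert ((q - 1) * (1 - / u) <= (q - 1) * ln u) by (apply Rmult_le_compat_l; lra).
  assert (u * (1 + (q - 1) * (1 - / u)) <= u * exp ((q - 1) * ln u))
    by (apply Rmult_le_compat_l; lra).
  nra.
Qed.

Lemma rpow_le_base u q : 0 <= u <= 1 -> 1 <= q -> rpow u q <= u.
Proof.
  intros Hu Hq; destruct (Req_dec u 0) as [->|N].
  { rewrite rpow_nonpos by lra; lra. }
  rewrite rpow_Rpower by lra.
  replace q with (1 + (q - 1)) by ring; rewrite Rpower_plus, Rpower_1 by lra.
  assert (Rpower u (q - 1) <= 1); [|nra].
  replace 1 with (Rpower 1 (q - 1)) at 2; [apply Rle_Rpower_l; lra|].
  unfold Rpower; rewrite ln_1, Rmult_0_r; apply exp_0.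
Qed.

(** After division by x + y this is t^q <= t on [0,1], summed over two numbers t of sum 1. It takes
    the place of Minkowski's inequality when the two bounds on |p| are merged. *)
Lemma rpow_superadd x y q :
  0 <= x -> 0 <= y -> 1 <= q -> rpow x q + rpow y q <= rpow (x + y) q.
Proof.
  intros Hx Hy Hq; destruct (Req_dec (x + y) 0) as [E|N].
  { rewrite !rpow_nonpos by lra; lra. }
  set (s := x + y) in *; assert (0 < s) by (unfold s in *; lra).
  assert (forall v, 0 <= v <= s -> rpow v q <= rpow s q * (v / s)) as K.
  { intros v Hv; replace v with (s * (v / s)) at 1 by (field; lra).
    assert (0 <= v / s <= 1).
    { split; [apply Rmult_le_pos; [lra|left; apply Rinv_0_lt_compat; lra]|].
      apply Rmult_le_reg_r with s; [lra|]; unfold Rdiv;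
        rewrite Rmult_assoc, Rinv_l; lra. }
    rewrite rpow_mult by lra; apply Rmult_le_compat_l;
      [apply rpow_ge0|apply rpow_le_base; lra]. }
  pose proof (K x ltac:(unfold s; lra)); pose proof (K y ltac:(unfold s; lra)).
  assert (rpow s q * (x / s) + rpow s q * (y / s) = rpow s q)
    by (replace y with (s - x) by (unfold s; ring); field; lra).
  lra.
Qed.

(** * The maximum principle *)

Definition continuous_at (F : Cx -> R) (z : Cx) : Prop :=
  forall eps, 0 < eps -> exists del, 0 < del /\
    forall w, Cmod (Csub w z) < del -> Rabs (F w - F z) < eps.

(* A Lebesgue number argument. *)
Lemma uniform_margin (Q : Cx -> R -> Prop) (M : R) :
  (forall w e e', Q w e -> 0 < e' <= e -> Q w e') ->
  (forall z, exists del, 0 < del /\ forall w, Cmod (Csub w z) < del -> Q w del) ->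
  exists e, 0 < e /\ forall w, Cmod w <= M -> Q w e.
Proof.
  intros Hmono Hloc.
  (* The radius is 2 [del] because the compactness theorem provides closeness [del] in each
     coordinate, hence only 2 [del] in modulus. *)
  assert (forall u v, exists del : posreal, forall w,
    Cmod (Csub w (u, v)) < 2 * del -> Q w del) as Hloc'.
  { intros u v; destruct (Hloc (u, v)) as [del [Hdel Hw]].
    assert (0 < del / 2) as Hd by lra; exists (mkposreal _ Hd); cbn; intros w Hwd.
    apply Hmono with del; [apply Hw|]; lra. }
  set (delta u v := proj1_sig (constructive_indefinite_description _ (Hloc' u v))).
  assert (forall u v w, Cmod (Csub w (u, v)) < 2 * delta u v -> Q w (delta u v)) as HQ.
  { intros u v; unfold delta; apply proj2_sig. }
  destruct (Compactness.compactness_value_2d (-M) M (-M) M delta) as [e He].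
  exists e; split; [apply cond_pos|]; intros w HwM; apply NNPP; intros Hn.
  pose proof (abs_fst_le_Cmod w) as H1; pose proof (abs_snd_le_Cmod w) as H2.
  apply (He (fst w) (snd w)).
  { apply Rabs_bound; lra. }
  { apply Rabs_bound; lra. }
  intros (u & v & _ & _ & Hu & Hv & Hle); apply Hn.
  apply Hmono with (delta u v); [|split; [apply cond_pos|exact Hle]].
  apply HQ; eapply Rle_lt_trans; [apply Cmod_le_abs|].
  unfold Csub, Cadd, Copp; cbn [fst snd]; fold (fst w - u); fold (snd w - v).
  unfold Rminus in *; lra.
Qed.

(** [uniform_margin] serves twice: with F <= 1/e it gives boundedness; and if the supremum S were
    not attained, F <= S - e on K would hold for one e > 0. Near points outside K the latter is
    vacuous because K is closed. *)
Lemma extreme_value (K : Cx -> Prop) (F : Cx -> R) :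
  closed K -> bounded K -> (exists z, K z) -> (forall z, continuous_at F z) ->
  exists z, K z /\ forall w, K w -> F w <= F z.
Proof.
  intros Hcl [M HM] [z0 Hz0] HF.
  assert (exists e, 0 < e /\ forall w, Cmod w <= M -> F w <= / e) as [e [He Hb]].
  { apply (uniform_margin (fun w e => F w <= / e)).
    - intros w e e' H He; apply Rle_trans with (/ e); [easy|].
      apply Rinv_le_contravar; lra.
    - intros z; destruct (HF z 1 ltac:(lra)) as [del [Hdel Hw]].
      pose proof (Rabs_pos (F z)).
      assert (0 < / (Rabs (F z) + 1)) by (apply Rinv_0_lt_compat; lra).
      exists (Rmin del (/ (Rabs (F z) + 1))); split; [apply Rmin_pos; lra|].
      intros w Hwz; specialize (Hw w (Rlt_le_trans _ _ _ Hwz (Rmin_l _ _))).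
      apply Rabs_def2 in Hw; pose proof (Rle_abs (F z)).
      apply Rle_trans with (/ / (Rabs (F z) + 1)); [rewrite Rinv_inv; lra|].
      apply Rinv_le_contravar;
        [apply Rmin_pos; lra|apply Rmin_r]. }
  destruct (completeness (fun y => exists w, K w /\ y = F w)) as [S [HS1 HS2]].
  { exists (/ e); intros y [w [Hw ->]]; apply Hb, HM, Hw. }
  { exists (F z0), z0; easy. }
  apply NNPP; intros Hno.
  assert (forall z, K z -> F z < S) as Hlt.
  { intros z Hz; destruct (Rle_lt_dec S (F z)) as [H|H]; [|easy].
    exfalso; apply Hno; exists z; split; [easy|]; intros w Hw.
    apply Rle_trans with S; [apply HS1; exists w; easy|easy]. }
  assert (exists e, 0 < e /\ forall w, Cmod w <= M -> K w -> F w <= S - e)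
    as [e2 [He2 Hb2]].
  { apply (uniform_margin (fun w e => K w -> F w <= S - e)).
    - intros w e1 e' H He1 Hw; specialize (H Hw); lra.
    - intros z; destruct (classic (K z)) as [Hz|Hz].
      + specialize (Hlt z Hz).
        destruct (HF z ((S - F z) / 2) ltac:(lra)) as [del [Hdel Hw]].
        exists (Rmin del ((S - F z) / 2)); split; [apply Rmin_pos; lra|].
        intros w Hwz _; specialize (Hw w (Rlt_le_trans _ _ _ Hwz (Rmin_l _ _))).
        apply Rabs_def2 in Hw; pose proof (Rmin_r del ((S - F z) / 2)); lra.
      + apply NNPP; intros Hn; apply Hz, Hcl; intros del Hdel.
        apply NNPP; intros Hn2; apply Hn; exists del; split; [easy|].
        intros w Hw HKw; exfalso; apply Hn2; exists w; easy. }
  assert (S <= S - e2); [|lra].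
  apply HS2; intros y [w [Hw ->]]; apply Hb2; [apply HM|]; exact Hw.
Qed.

Lemma not_boundary_interior (K : Cx -> Prop) z :
  K z -> ~ boundary K z -> interior_point K z.
Proof.
  intros Hz Hn; apply NNPP; intros Hi; apply Hn; split; [easy|].
  intros eps Heps; apply NNPP; intros H; apply Hi; exists eps; split; [easy|].
  intros w Hw; apply NNPP; intros HKw; apply H; exists w; easy.
Qed.

(* [z + u i^j], j = 0..3, is a 4-point mean exact for polynomials of degree 2, while the mean
   of [|.|^2] over these points exceeds [|z|^2]: this rules out interior maxima. *)
Lemma no_interior_max zs (c : Cx) (eps : R) z r :
  0 < eps -> 0 < r ->
  ~ (forall w, Cmod (Csub w z) < r ->
       Cmod (Csub (root_prod zs w) c) + eps * (Cmod w * Cmod w) <=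
       Cmod (Csub (root_prod zs z) c) + eps * (Cmod z * Cmod z)).
Proof.
  intros Heps Hr Hmax.
  destruct (root_prod_taylor2 zs z) as (c1 & c2 & B & HB & HT).
  (* The three terms keep the four points in the ball, make the expansion valid, and give B s^3 <
     eps s^2. *)
  set (s := Rmin (r / 2) (Rmin 1 (eps / (2 * (B + 1))))).
  assert (0 < eps / (2 * (B + 1))) by (apply Rdiv_lt_0_compat; lra).
  assert (0 < s) by (repeat apply Rmin_pos; lra).
  assert (s < r) by (pose proof (Rmin_l (r / 2) (Rmin 1 (eps / (2 * (B + 1)))));
    unfold s; lra).
  assert (s <= 1 /\ s <= eps / (2 * (B + 1))) as [Hs1 Hs2].
  { pose proof (Rmin_r (r / 2) (Rmin 1 (eps / (2 * (B + 1))))) as Hm; fold s in Hm.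
    pose proof (Rmin_l 1 (eps / (2 * (B + 1))));
      pose proof (Rmin_r 1 (eps / (2 * (B + 1)))); lra. }
  assert (B * s < eps) as HBs.
  { apply (Rmult_le_compat_l (2 * (B + 1))) in Hs2; [|lra].
    replace (2 * (B + 1) * (eps / (2 * (B + 1)))) with eps in Hs2 by (field; lra); nra. }
  set (P := root_prod zs) in *.
  set (err u := Csub (P (Cadd z u)) (Cadd (P z) (Cadd (Cmul c1 u) (Cmul c2 (Cmul u u))))) in *.
  assert (forall u, Cmod u = s -> Cmod (err u) <= B * (s * s * s)) as Herr.
  { intros u Hu; rewrite <- Hu; apply HT; lra. }
  assert (forall u, Cmod u = s ->
    Cmod (Csub (P (Cadd z u)) c) + eps * (Cmod (Cadd z u) * Cmod (Cadd z u)) <=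
    Cmod (Csub (P z) c) + eps * (Cmod z * Cmod z)) as Hmax'.
  { intros u Hu; apply Hmax; replace (Csub (Cadd z u) z) with u by ring; lra. }
  set (u1 := (s, 0) : Cx); set (u2 := (0, s) : Cx).
  assert (Cmod u1 = s /\ Cmod u2 = s) as [E1 E2].
  { unfold Cmod, u1, u2; cbn [fst snd]; rewrite Rmult_0_l, Rplus_0_l, Rplus_0_r.
    split; apply sqrt_square; lra. }
  assert (Cmul u2 u2 = Copp (Cmul u1 u1)) as Eu
    by (unfold u1, u2, Cmul, Copp; cbn [fst snd]; f_equal; ring).
  set (p1 := Csub (P (Cadd z u1)) c); set (p2 := Csub (P (Cadd z u2)) c).
  set (p3 := Csub (P (Cadd z (Copp u1))) c); set (p4 := Csub (P (Cadd z (Copp u2))) c).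
  set (four := Cadd (Cadd C1 C1) (Cadd C1 C1)).
  assert (Cmul four (Csub (P z) c) = Cadd (Cadd (Cadd p1 p2) (Cadd p3 p4))
     (Copp (Cadd (Cadd (err u1) (err u2)) (Cadd (err (Copp u1)) (err (Copp u2))))))
    as Emean.
  { unfold err, p1, p2, p3, p4, four.
    replace (Cmul (Copp u1) (Copp u1)) with (Cmul u1 u1) by ring.
    replace (Cmul (Copp u2) (Copp u2)) with (Cmul u2 u2) by ring.
    rewrite Eu; ring. }
  assert (Cmod four = 4) as E4.
  { unfold Cmod, four, Cadd, C1; cbn [fst snd].
    replace (_ + _) with (4 * 4) by ring; apply sqrt_square; lra. }
  assert (4 * Cmod (Csub (P z) c) <=
     Cmod p1 + Cmod p2 + Cmod p3 + Cmod p4 + 4 * (B * (s * s * s))) as Hmean.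
  { rewrite <- E4, <- Cmod_mul, Emean.
    eapply Rle_trans; [apply Cmod_triangle|]; rewrite Cmod_opp.
    pose proof (Cmod_triangle (Cadd p1 p2) (Cadd p3 p4)).
    pose proof (Cmod_triangle p1 p2); pose proof (Cmod_triangle p3 p4).
    pose proof (Cmod_triangle (Cadd (err u1) (err u2)) (Cadd (err (Copp u1)) (err (Copp u2)))).
    pose proof (Cmod_triangle (err u1) (err u2)).
    pose proof (Cmod_triangle (err (Copp u1)) (err (Copp u2))).
    pose proof (Herr u1 E1); pose proof (Herr u2 E2).
    pose proof (Herr (Copp u1) ltac:(rewrite Cmod_opp; easy)).
    pose proof (Herr (Copp u2) ltac:(rewrite Cmod_opp; easy)). rewrite E4. lra. }
  pose proof (Hmax' u1 E1) as M1; pose proof (Hmax' u2 E2) as M2.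
  pose proof (Hmax' (Copp u1) ltac:(rewrite Cmod_opp; easy)) as M3.
  pose proof (Hmax' (Copp u2) ltac:(rewrite Cmod_opp; easy)) as M4.
  fold p1 in M1; fold p2 in M2; fold p3 in M3; fold p4 in M4.
  rewrite !Cmod_sqr in M1, M2, M3, M4.
  unfold u1, u2, Cadd, Copp in M1, M2, M3, M4; cbn [fst snd] in M1, M2, M3, M4.
  assert (eps * (s * s) <= B * (s * s * s)) by lra.
  assert (0 < s * s) by nra; nra.
Qed.

(** The term eps |w|^2 makes the mean value argument strict, so that a maximum of the perturbed
    function lies on the boundary even if |p - c| is constant. It costs at most eps M^2 <= e, and e
    is arbitrary. *)
Lemma maximum_principle (K : Cx -> Prop) zs c T :
  closed K -> bounded K ->
  (forall z, boundary K z -> Cmod (Csub (root_prod zs z) c) <= T) ->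
  forall z, K z -> Cmod (Csub (root_prod zs z) c) <= T.
Proof.
  intros Hcl Hb HT z Hz; pose proof Hb as [M HM].
  apply Rle_plus_epsilon; intros e He.
  set (eps := e / (M * M + 1)).
  assert (0 < eps) by (apply Rdiv_lt_0_compat; nra).
  destruct (extreme_value K
    (fun w => Cmod (Csub (root_prod zs w) c) + eps * (Cmod w * Cmod w))) as [z1 [Hz1 Hmax]];
    try easy.
  - exists z; easy.
  - intros w e' He'; pose proof (Cmod_ge0 w).
    destruct (root_prod_smooth zs (Cmod w + 1) ltac:(lra)) as [B [HB Hsm]].
    set (L := B + eps * (2 * Cmod w + 1) + 1).
    assert (0 < L) by (unfold L; nra).
    exists (Rmin 1 (e' / L)).
    split; [apply Rmin_pos; [lra|apply Rdiv_lt_0_compat; lra]|].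
    intros v Hv; pose proof (Rlt_le_trans _ _ _ Hv (Rmin_l _ _)).
    pose proof (Rlt_le_trans _ _ _ Hv (Rmin_r _ _)) as Hv2.
    pose proof (Cmod_le_add v w); pose proof (Cmod_le_add w v) as Hwv.
    rewrite Cmod_sub_sym in Hwv.
    destruct (Hsm w v ltac:(lra) ltac:(lra)) as [_ [HL _]].
    set (u := Cmod (Csub v w)) in *.
    assert (0 <= u) by apply Cmod_ge0.
    assert (u * L < e') as HuL.
    { apply (Rmult_lt_compat_r L) in Hv2; [|easy].
      replace (e' / L * L) with e' in Hv2 by (field; lra); easy. }
    set (P := root_prod zs) in *.
    assert (forall x y, Cmod (Csub (P x) c) <=
      Cmod (Csub (P y) c) + Cmod (Csub (P x) (P y))) as Htri.
    { intros x y; pose proof (Cmod_sub_triangle (P x) (P y) c); lra. }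
    pose proof (Htri v w) as T1; pose proof (Htri w v) as T2.
    rewrite (Cmod_sub_sym (P w) (P v)) in T2.
    assert (Rabs (Cmod v * Cmod v - Cmod w * Cmod w) <= (2 * Cmod w + 1) * u) as Hsq.
    { pose proof (Cmod_ge0 v); apply Rabs_le; split; nra. }
    apply Rabs_bound in Hsq.
    assert (eps * (Cmod v * Cmod v - Cmod w * Cmod w) <= eps * ((2 * Cmod w + 1) * u))
      by (apply Rmult_le_compat_l; lra).
    assert (eps * - ((2 * Cmod w + 1) * u) <= eps * (Cmod v * Cmod v - Cmod w * Cmod w))
      by (apply Rmult_le_compat_l; lra).
    unfold L in HuL; cbv beta; fold P; apply Rabs_def1; lra.
  - assert (boundary K z1) as Hbd.
    { apply NNPP; intros Hn; destruct (not_boundary_interior K z1 Hz1 Hn) as [r [Hr Hball]].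
      apply (no_interior_max zs c eps z1 r); try easy.
      intros w Hw; apply Hmax, Hball, Hw. }
    specialize (HT z1 Hbd); specialize (Hmax z Hz); cbv beta in Hmax.
    specialize (HM z1 Hz1); pose proof (Cmod_ge0 z1); pose proof (Cmod_ge0 z).
    assert (eps * (Cmod z1 * Cmod z1) <= e).
    { apply Rle_trans with (eps * (M * M + 1)); [|unfold eps; right; field; nra].
      apply Rmult_le_compat_l; nra. }
    nra.
Qed.

(** * Supporting lines *)

Lemma Cx_ext (z w : Cx) : fst z = fst w -> snd z = snd w -> z = w.
Proof. destruct z, w; cbn; intros -> ->; reflexivity. Qed.

Lemma boundary_not_interior (K : Cx -> Prop) z : boundary K z -> ~ interior_point K z.
Proof.
  intros [_ H] [r [Hr Hb]]; destruct (H r Hr) as [w [Hw Hd]]; apply Hw, Hb, Hd.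
Qed.

(** If the point z behind [zeta] were in K, the homothety with centre z and ratio s/(1+s) would map
    a ball around [o] to a ball in K around [zeta]. *)
Lemma beyond_boundary (K : Cx -> Prop) zeta o s :
  convex K -> boundary K zeta -> interior_point K o -> 0 < s ->
  ~ K (Cadd zeta (Cscal (- s) (Csub o zeta))).
Proof.
  intros Hc Hb [r [Hr Hball]] Hs HK; apply (boundary_not_interior K zeta Hb).
  exists (r * s / (1 + s)); split; [apply Rdiv_lt_0_compat; nra|]; intros w Hw.
  set (z := Cadd zeta _) in HK.
  set (o' := Cadd o (Cscal ((1 + s) / s) (Csub w zeta))).
  assert (K o') as Ho.
  { apply Hball; unfold o'.
    replace (Csub (Cadd o _) o) with (Cscal ((1 + s) / s) (Csub w zeta)) by ring.
    rewrite Cmod_scal, Rabs_pos_eq by (left; apply Rdiv_lt_0_compat; lra).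
    apply Rmult_lt_reg_l with (s / (1 + s)); [apply Rdiv_lt_0_compat; lra|].
    replace (s / (1 + s) * ((1 + s) / s * Cmod (Csub w zeta))) with (Cmod (Csub w zeta))
      by (field; lra).
    replace (s / (1 + s) * r) with (r * s / (1 + s)) by (field; lra); easy. }
  assert (0 <= s / (1 + s) <= 1) as Hq.
  { split; [left; apply Rdiv_lt_0_compat; lra|].
    apply Rmult_le_reg_r with (1 + s); [lra|]; unfold Rdiv;
      rewrite Rmult_assoc, Rinv_l; lra. }
  replace w with (Cadd (Cscal (1 - s / (1 + s)) z) (Cscal (s / (1 + s)) o'));
    [apply Hc; assumption|].
  unfold z, o', Cadd, Cscal, Csub, Copp, Cadd; apply Cx_ext; cbn [fst snd]; field; lra.
Qed.

Lemma Cre_mul_conj z w : Cre (Cmul z (Cconj w)) = fst z * fst w + snd z * snd w.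
Proof. unfold Cre, Cmul, Cconj; cbn [fst snd]; ring. Qed.

(* In the frame (e, i e), e pointing from the boundary point into K, the supporting line has as
   slope the supremum of the slopes of the points on one side of the axis. *)
Lemma outer_normal_exists (K : Cx -> Prop) zeta :
  convex_domain K -> boundary K zeta -> exists nu, outer_normal K zeta nu.
Proof.
  intros (Hc & Hcl & Hbd & o & Ho) Hz.
  set (e1 := fst o - fst zeta); set (e2 := snd o - snd zeta).
  set (N := e1 * e1 + e2 * e2).
  assert (0 < N) as HN.
  { destruct (Rle_lt_dec N 0) as [h|h]; [|easy]; exfalso.
    assert (e1 = 0 /\ e2 = 0) as [E1 E2] by (unfold N in h; split; nra).
    apply (boundary_not_interior K zeta Hz).
    replace zeta with o; [easy|]; apply Cx_ext; unfold e1, e2 in *; lra. }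
  set (al z := (fst z - fst zeta) * e1 + (snd z - snd zeta) * e2).
  set (be z := (snd z - snd zeta) * e1 - (fst z - fst zeta) * e2).
  (* [al] and [be] are the coordinates along e and i e, scaled by |e|. A point of K on the axis with
     [al] < 0 is one that [beyond_boundary] excludes. *)
  assert (forall z, K z -> be z = 0 -> 0 <= al z) as Haxis.
  { intros z Kz Hbe; destruct (Rle_lt_dec 0 (al z)) as [h|h]; [easy|]; exfalso.
    apply (beyond_boundary K zeta o (- al z / N) Hc Hz Ho).
    { apply Rdiv_lt_0_compat; lra. }
    replace (Cadd _ _) with z; [easy|].
    unfold Cadd, Cscal, Csub, Copp, Cadd; apply Cx_ext; cbn [fst snd].
    - fold (fst o - fst zeta); fold e1.
      replace (- (- al z / N)) with (al z / N) by (field; lra).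
      assert (fst z - fst zeta = al z / N * e1); [|lra].
      apply Rmult_eq_reg_r with N; [|lra].
      replace (al z / N * e1 * N) with (al z * e1 - be z * e2)
        by (rewrite Hbe; field; lra).
      unfold al, be, N; ring.
    - fold (snd o - snd zeta); fold e2.
      replace (- (- al z / N)) with (al z / N) by (field; lra).
      assert (snd z - snd zeta = al z / N * e2); [|lra].
      apply Rmult_eq_reg_r with N; [|lra].
      replace (al z / N * e2 * N) with (al z * e2 + be z * e1)
        by (rewrite Hbe; field; lra).
      unfold al, be, N; ring. }
  assert (forall z w, K z -> K w -> 0 < be z -> be w < 0 -> al w / be w <= al z / be z)
    as Hslope.
  { intros z w Kz Kw Bz Bw.
    (* At this parameter the segment from z to w crosses the axis, where [Haxis] applies. *)
    set (t := be z / (be z - be w)).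
    assert (0 <= t <= 1) as Ht.
    { unfold t; split; [left; apply Rdiv_lt_0_compat; lra|].
      apply Rmult_le_reg_r with (be z - be w); [lra|].
      replace (be z / (be z - be w) * (be z - be w)) with (be z) by (field; lra); lra. }
    pose proof (Haxis _ (Hc z w t Kz Kw Ht)) as H.
    assert (forall l, al (Cadd (Cscal (1 - l) z) (Cscal l w)) = (1 - l) * al z + l * al w)
      as Eal by (intros l; unfold al, Cadd, Cscal; cbn [fst snd]; ring).
    assert (forall l, be (Cadd (Cscal (1 - l) z) (Cscal l w)) = (1 - l) * be z + l * be w)
      as Ebe by (intros l; unfold be, Cadd, Cscal; cbn [fst snd]; ring).
    rewrite Eal, Ebe in H.
    assert (0 <= (1 - t) * al z + t * al w) as H'
      by (apply H; unfold t; field; lra).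
    apply (Rmult_le_compat_l (be z - be w)) in H'; [|lra].
    replace ((be z - be w) * ((1 - t) * al z + t * al w))
      with (al w * be z - al z * be w) in H' by (unfold t; field; lra).
    apply Rmult_le_reg_r with (be z * - be w); [nra|].
    replace (al w / be w * (be z * - be w)) with (- (al w * be z)) by (field; lra).
    replace (al z / be z * (be z * - be w)) with (- (al z * be w)) by (field; lra).
    lra. }
  assert (exists p m, K p /\ K m /\ 0 < be p /\ be m < 0) as (p & m & Kp & Km & Bp & Bm).
  { destruct Ho as [r [Hr Hball]].
    set (v := (- e2, e1) : Cx).
    assert (0 < Cmod v) as Hv.
    { destruct (Cmod_ge0 v) as [h|h]; [easy|]; exfalso.
      pose proof (Cmod_sqr v) as E; rewrite <- h in E; unfold v in E; cbn [fst snd] in E.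
      unfold N in HN; nra. }
    set (s := r / (2 * Cmod v)); assert (0 < s) as Hs by (apply Rdiv_lt_0_compat; lra).
    assert (forall t, Rabs t = s -> K (Cadd o (Cscal t v))) as HK.
    { intros t Ht; apply Hball.
      replace (Csub (Cadd o (Cscal t v)) o) with (Cscal t v) by ring.
      rewrite Cmod_scal, Ht; unfold s.
      replace (r / (2 * Cmod v) * Cmod v) with (r / 2) by (field; lra); lra. }
    assert (forall t, be (Cadd o (Cscal t v)) = t * N) as Ebe
      by (intros t; unfold be, v, N, Cadd, Cscal, e1, e2; cbn [fst snd]; ring).
    exists (Cadd o (Cscal s v)), (Cadd o (Cscal (- s) v)); repeat split.
    - apply HK, Rabs_pos_eq; lra.
    - apply HK; rewrite Rabs_Ropp; apply Rabs_pos_eq; lra.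
    - rewrite Ebe; nra.
    - rewrite Ebe; nra. }
  destruct (completeness (fun y => exists w, K w /\ be w < 0 /\ y = al w / be w))
    as [M [HM1 HM2]].
  { exists (al p / be p); intros y (w & Kw & Bw & ->); apply Hslope; assumption. }
  { exists (al m / be m), m; easy. }
  assert (forall z, K z -> M * be z <= al z) as Hsup.
  { intros z Kz; destruct (Rtotal_order (be z) 0) as [h|[h|h]].
    - assert (al z / be z <= M) as H by (apply HM1; exists z; easy).
      apply (Rmult_le_compat_r (- be z)) in H; [|lra].
      replace (al z / be z * - be z) with (- al z) in H by (field; lra); lra.
    - rewrite h, Rmult_0_r; apply Haxis; assumption.
    - assert (M <= al z / be z) as H.
      { apply HM2; intros y (w & Kw & Bw & ->); apply Hslope; assumption. }
      apply (Rmult_le_compat_r (be z)) in H; [|lra].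
      replace (al z / be z * be z) with (al z) in H by (field; lra); lra. }
  (* The normal direction is -(e - M i e): its product with z - [zeta] is M [be] - [al], and its
     squared length N (1 + M^2) is positive. *)
  set (n1 := - (e1 + M * e2)); set (n2 := - (e2 - M * e1)).
  set (v := (n1, n2) : Cx).
  assert (0 < Cmod v) as Hv.
  { destruct (Cmod_ge0 v) as [h|h]; [easy|]; exfalso.
    pose proof (Cmod_sqr v) as E; rewrite <- h in E; unfold v in E; cbn [fst snd] in E.
    unfold n1, n2, N in *; nra. }
  exists (Cscal (/ Cmod v) v); split; [easy|split].
  - rewrite Cmod_scal, Rabs_pos_eq by (left; apply Rinv_0_lt_compat; easy); field; lra.
  - intros z Kz; rewrite Cre_mul_conj; specialize (Hsup z Kz).
    unfold Cscal, Csub, Cadd, Copp; cbn [fst snd].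
    replace (_ + _) with (/ Cmod v * (M * be z - al z))
      by (unfold v, n1, n2, al, be; cbn [fst snd]; ring).
    assert (0 < / Cmod v) by (apply Rinv_0_lt_compat; easy); nra.
Qed.

(** Take an outer normal at the middle one of the three points. The other two, on opposite sides
    along the line, force its tangential component to vanish; P and Q, strictly on opposite sides of
    the line, do the same for the other component. But the normal has length 1. *)
Lemma convex_no_three_collinear (K : Cx -> Prop) e1 e2 (A B C P Q : Cx) v :
  convex_domain K -> e1 * e1 + e2 * e2 = 1 ->
  boundary K A -> boundary K B -> boundary K C -> A <> B -> B <> C -> A <> C ->
  e1 * fst A + e2 * snd A = v -> e1 * fst B + e2 * snd B = v ->
  e1 * fst C + e2 * snd C = v ->
  K P -> K Q -> e1 * fst P + e2 * snd P < v < e1 * fst Q + e2 * snd Q -> False.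
Proof.
  intros HK He bA bB bC nAB nBC nAC vA vB vC KP KQ [HP HQ].
  set (m z := e1 * snd z - e2 * fst z).
  assert (forall X Y Z, boundary K X -> boundary K Y -> boundary K Z ->
    e1 * fst X + e2 * snd X = v -> e1 * fst Y + e2 * snd Y = v ->
    e1 * fst Z + e2 * snd Z = v -> m X < m Y -> m Y < m Z -> False) as Hmid.
  { intros X Y Z bX bY bZ vX vY vZ h1 h2.
    destruct (outer_normal_exists K Y HK bY) as [nu (_ & Hnu & Hn)].
    set (k := e1 * fst nu + e2 * snd nu); set (t := e1 * snd nu - e2 * fst nu).
    assert (forall W, K W ->
      (e1 * fst W + e2 * snd W - v) * k + (m W - m Y) * t <= 0) as Hn'.
    { intros W KW; specialize (Hn W KW); rewrite Cre_mul_conj in Hn.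
      unfold Csub, Cadd, Copp in Hn; cbn [fst snd] in Hn.
      rewrite <- vY; unfold k, t, m.
      replace (_ + _) with ((e1 * e1 + e2 * e2) *
        ((fst W + - fst Y) * fst nu + (snd W + - snd Y) * snd nu)) by ring.
      rewrite He; lra. }
    pose proof (Hn' X (proj1 bX)) as HX; pose proof (Hn' Z (proj1 bZ)) as HZ.
    rewrite vX in HX; rewrite vZ in HZ.
    assert (t = 0) as Et by nra.
    pose proof (Hn' P KP) as H1; pose proof (Hn' Q KQ) as H2; rewrite Et in H1, H2.
    assert (k = 0) as Ek by nra.
    pose proof (Cmod_sqr nu) as E; rewrite Hnu in E.
    assert (fst nu * fst nu + snd nu * snd nu = k * k + t * t) as E2.
    { transitivity ((e1 * e1 + e2 * e2) * (fst nu * fst nu + snd nu * snd nu));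
        [rewrite He; ring|unfold k, t; ring]. }
    rewrite Et, Ek in E2; lra. }
  assert (forall X Y, X <> Y -> e1 * fst X + e2 * snd X = v ->
    e1 * fst Y + e2 * snd Y = v -> m X < m Y \/ m Y < m X) as Hne.
  { intros X Y n vX vY; destruct (Rtotal_order (m X) (m Y)) as [h|[h|h]]; [tauto| |tauto].
    exfalso; apply n.
    assert (forall W, fst W = e1 * (e1 * fst W + e2 * snd W) - e2 * m W) as F1.
    { intros W; transitivity ((e1 * e1 + e2 * e2) * fst W);
        [rewrite He; ring|unfold m; ring]. }
    assert (forall W, snd W = e2 * (e1 * fst W + e2 * snd W) + e1 * m W) as F2.
    { intros W; transitivity ((e1 * e1 + e2 * e2) * snd W);
        [rewrite He; ring|unfold m; ring]. }
    apply Cx_ext; [rewrite (F1 X), (F1 Y)|rewrite (F2 X), (F2 Y)];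
      rewrite vX, vY, h; reflexivity. }
  destruct (Hne A B nAB vA vB) as [a|a], (Hne B C nBC vB vC) as [b|b],
    (Hne A C nAC vA vC) as [c|c]; try lra.
  - exact (Hmid A B C bA bB bC vA vB vC a b).
  - exact (Hmid A C B bA bC bB vA vC vB c b).
  - exact (Hmid C A B bC bA bB vC vA vB c a).
  - exact (Hmid B A C bB bA bC vB vA vC a c).
  - exact (Hmid B C A bB bC bA vB vC vA b c).
  - exact (Hmid C B A bC bB bA vC vB vA b a).
Qed.

(** * Length of the boundary *)

Lemma IVT_between (f : R -> R) a b v : continuity f -> a < b ->
  f a < v < f b \/ f b < v < f a -> exists c, a < c < b /\ f c = v.
Proof.
  intros Hf Hab H.
  destruct (IVT_cor (fun x => f x - v) a b) as [c [Hc E]].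
  - intros x; apply continuity_pt_minus; [apply Hf|apply continuity_pt_const; easy].
  - lra.
  - destruct H; nra.
  - exists c; split; [|lra].
    assert (c <> a) by (intros ->; lra); assert (c <> b) by (intros ->; lra); lra.
Qed.

(** The parameter 1 is excluded because a closed curve returns there to its start. The extreme
    values are excluded because a coordinate may be constant on a whole edge of K lying in a
    supporting line. *)
Definition takes_no_value_thrice (f : R -> R) (lo hi : R) : Prop :=
  forall a b c, 0 <= a -> a < b -> b < c -> c < 1 ->
    f a = f b -> f b = f c -> lo < f b < hi -> False.

(* Each failure of monotonicity on one of the pieces [0,s], [s,t], [t,1] yields, by
   the intermediate value theorem, a value taken three times. *)
Lemma variation_min_first (f : R -> R) s t : continuity f ->
  0 <= s <= 1 -> 0 <= t <= 1 -> s <= t ->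
  (forall x, 0 <= x <= 1 -> f s <= f x <= f t) ->
  takes_no_value_thrice f (f s) (f t) ->
  exists G : R -> R, (forall x y, 0 <= x -> x <= y -> y <= 1 ->
    Rabs (f y - f x) <= G y - G x) /\ G 1 - G 0 <= 3 * (f t - f s).
Proof.
  intros Hf Hs Ht Hst Hext H3.
  assert (forall u v, f u < f v -> 0 <= u <= 1 -> 0 <= v <= 1 -> exists c,
    f u < c < f v /\ f s < c < f t) as Hc.
  { intros u v h hu hv; exists ((f u + f v) / 2).
    pose proof (Hext u hu); pose proof (Hext v hv); lra. }
  assert (forall u v, 0 <= u -> u <= v -> v <= s -> f v <= f u) as M1.
  { intros u v hu huv hv; apply Rnot_lt_le; intros h.
    destruct (Hc u v h ltac:(lra) ltac:(lra)) as [c [Hc1 Hc2]].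
    assert (u < v) by (destruct huv as [|E]; [easy|rewrite E in h; lra]).
    assert (v < s) by (destruct hv as [|E]; [easy|rewrite E in *; lra]).
    assert (s < t) by (destruct Hst as [|E]; [easy|rewrite E in *; lra]).
    destruct (IVT_between f u v c Hf) as [x1 [h1 E1]]; [lra|lra|].
    destruct (IVT_between f v s c Hf) as [x2 [h2 E2]]; [lra|lra|].
    destruct (IVT_between f s t c Hf) as [x3 [h3 E3]]; [lra|lra|].
    apply (H3 x1 x2 x3); lra. }
  assert (forall u v, s <= u -> u <= v -> v <= t -> f u <= f v) as M2.
  { intros u v hu huv hv; apply Rnot_lt_le; intros h.
    destruct (Hc v u h ltac:(lra) ltac:(lra)) as [c [Hc1 Hc2]].
    assert (u < v) by (destruct huv as [|E]; [easy|rewrite E in h; lra]).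
    assert (v < t) by (destruct hv as [|E]; [easy|rewrite E in *; lra]).
    assert (s < u) by (destruct hu as [|E]; [easy|rewrite <- E in *; lra]).
    destruct (IVT_between f s u c Hf) as [x1 [h1 E1]]; [lra|lra|].
    destruct (IVT_between f u v c Hf) as [x2 [h2 E2]]; [lra|lra|].
    destruct (IVT_between f v t c Hf) as [x3 [h3 E3]]; [lra|lra|].
    apply (H3 x1 x2 x3); lra. }
  assert (forall u v, t <= u -> u <= v -> v <= 1 -> f v <= f u) as M3.
  { intros u v hu huv hv; apply Rnot_lt_le; intros h.
    destruct (Hc u v h ltac:(lra) ltac:(lra)) as [c [Hc1 Hc2]].
    assert (u < v) by (destruct huv as [|E]; [easy|rewrite E in h; lra]).
    assert (t < u) by (destruct hu as [|E]; [easy|rewrite <- E in *; lra]).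
    assert (s < t) by (destruct Hst as [|E]; [easy|rewrite E in *; lra]).
    destruct (IVT_between f s t c Hf) as [x1 [h1 E1]]; [lra|lra|].
    destruct (IVT_between f t u c Hf) as [x2 [h2 E2]]; [lra|lra|].
    destruct (IVT_between f u v c Hf) as [x3 [h3 E3]]; [lra|lra|].
    apply (H3 x1 x2 x3); lra. }
  (* This is the variation of f, up to a constant: f falls, rises and falls on the three pieces,
     each term follows one piece and is constant on the others, and each grows by at most f t - f
     s. *)
  exists (fun x => - f (Rmin x s) + f (Rmax s (Rmin x t)) - f (Rmax x t)); split.
  - intros x y hx hxy hy.
    assert (forall z, f z = f (Rmin z s) + f (Rmax s (Rmin z t)) - f s + f (Rmax z t) - f t)
      as Hdec.
    { intros z; unfold Rmin, Rmax; repeat destruct Rle_dec; try lra;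
        replace z with s by lra; lra. }
    rewrite (Hdec x), (Hdec y).
    assert (f (Rmin y s) <= f (Rmin x s)) as K1.
    { apply M1; unfold Rmin; repeat destruct Rle_dec; lra. }
    assert (f (Rmax s (Rmin x t)) <= f (Rmax s (Rmin y t))) as K2.
    { apply M2; unfold Rmin, Rmax; repeat destruct Rle_dec; lra. }
    assert (f (Rmax y t) <= f (Rmax x t)) as K3.
    { apply M3; unfold Rmax; repeat destruct Rle_dec; lra. }
    apply Rabs_le; lra.
  - assert (forall z, 0 <= z <= 1 -> f s <= f (Rmin z s) <= f t) as B1.
    { intros z hz; apply Hext; unfold Rmin; destruct Rle_dec; lra. }
    assert (forall z, 0 <= z <= 1 -> f s <= f (Rmax s (Rmin z t)) <= f t) as B2.
    { intros z hz; apply Hext; unfold Rmin, Rmax; repeat destruct Rle_dec; lra. }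
    assert (forall z, 0 <= z <= 1 -> f s <= f (Rmax z t) <= f t) as B3.
    { intros z hz; apply Hext; unfold Rmax; destruct Rle_dec; lra. }
    pose proof (B1 0 ltac:(lra)); pose proof (B1 1 ltac:(lra)).
    pose proof (B2 0 ltac:(lra)); pose proof (B2 1 ltac:(lra)).
    pose proof (B3 0 ltac:(lra)); pose proof (B3 1 ltac:(lra)); lra.
Qed.

Lemma variation_bound (f : R -> R) s t : continuity f ->
  0 <= s <= 1 -> 0 <= t <= 1 ->
  (forall x, 0 <= x <= 1 -> f s <= f x <= f t) ->
  takes_no_value_thrice f (f s) (f t) ->
  exists G : R -> R, (forall x y, 0 <= x -> x <= y -> y <= 1 ->
    Rabs (f y - f x) <= G y - G x) /\ G 1 - G 0 <= 3 * (f t - f s).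
Proof.
  intros Hf Hs Ht Hext H3; destruct (Rle_lt_dec s t) as [h|h].
  { apply variation_min_first; assumption. }
  destruct (variation_min_first (fun x => - f x) t s) as [G [HG1 HG2]].
  - intros x; apply continuity_pt_opp, Hf.
  - easy.
  - easy.
  - lra.
  - intros x hx; specialize (Hext x hx); lra.
  - intros a b c h0 h1 h2 h4 E1 E2 E3; apply (H3 a b c); lra.
  - exists G; split; [|lra]; intros x y hx hxy hy.
    rewrite <- (Rabs_Ropp (f y - f x)).
    replace (- (f y - f x)) with (- f y - - f x) by ring; apply HG1; assumption.
Qed.

(** Composition with [clamp] extends functions on [0,1] to R. [boundary_param] gives continuity
    within [0,1] only, whereas the theorems of real analysis applied below want two-sided
    continuity, also at the endpoints. *)
Definition clamp (t : R) : R := Rmax 0 (Rmin t 1).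

Lemma clamp_bound t : 0 <= clamp t <= 1.
Proof. unfold clamp, Rmin, Rmax; repeat destruct Rle_dec; lra. Qed.

Lemma clamp_id t : 0 <= t <= 1 -> clamp t = t.
Proof. intros h; unfold clamp, Rmin, Rmax; repeat destruct Rle_dec; lra. Qed.

Lemma clamp_contraction s t : Rabs (clamp s - clamp t) <= Rabs (s - t).
Proof.
  unfold clamp, Rmin, Rmax; repeat destruct Rle_dec; unfold Rabs;
    repeat destruct Rcase_abs; lra.
Qed.

Lemma coordinate_variation (K : Cx -> Prop) gamma d e1 e2 :
  convex_domain K -> boundary_param K gamma -> diameter K d -> e1 * e1 + e2 * e2 = 1 ->
  exists G : R -> R, (forall x y, 0 <= x -> x <= y -> y <= 1 ->
    Rabs (e1 * (fst (gamma y) - fst (gamma x)) + e2 * (snd (gamma y) - snd (gamma x)))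
      <= G y - G x) /\ G 1 - G 0 <= 3 * d.
Proof.
  intros HK (Hcont & _ & Hinj & Hbd & _) [Hd _] He.
  set (l z := e1 * fst z + e2 * snd z).
  assert (forall z w, Rabs (l z - l w) <= Cmod (Csub z w)) as Hl.
  { intros z w; pose proof (Cmod_ge0 (Csub z w)); pose proof (Cmod_sqr (Csub z w)) as E.
    unfold Csub at 3 4 5 6, Cadd, Copp in E; cbn [fst snd] in E.
    set (a := fst z + - fst w) in *; set (b := snd z + - snd w) in *.
    replace (l z - l w) with (e1 * a + e2 * b) by (unfold l, a, b; ring).
    assert ((e1 * a + e2 * b) * (e1 * a + e2 * b) <= a * a + b * b).
    { replace (a * a + b * b) with ((e1 * e1 + e2 * e2) * (a * a + b * b))
        by (rewrite He; ring).
      pose proof (Rle_0_sqr (e1 * b - e2 * a)) as S; unfold Rsqr in S; nra. }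
    apply Rabs_le; split; nra. }
  set (f x := l (gamma (clamp x))).
  assert (continuity f) as Hf.
  { intros x eps Heps.
    destruct (Hcont (clamp x) (clamp_bound x) eps Heps) as [del [Hdel Hc]].
    exists del; split; [easy|]; intros y [_ Hy]; cbn in *; unfold Rdist in *.
    eapply Rle_lt_trans; [apply Hl|]; apply Hc; [apply clamp_bound|].
    eapply Rle_lt_trans; [apply clamp_contraction|easy]. }
  assert (forall x, 0 <= x <= 1 -> f x = l (gamma x)) as Efx
    by (intros x hx; unfold f; rewrite clamp_id; easy).
  destruct (continuity_ab_min f 0 1 ltac:(lra)) as [s [Hs1 Hs2]].
  { intros; apply Hf. }
  destruct (continuity_ab_maj f 0 1 ltac:(lra)) as [t [Ht1 Ht2]].
  { intros; apply Hf. }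
  destruct (variation_bound f s t Hf Hs2 Ht2) as [G [HG1 HG2]].
  - intros x hx; split; [apply Hs1|apply Ht1]; easy.
  - intros a b c h0 h1 h2 h3 E1 E2 [E3 E4].
    rewrite !Efx in * by lra.
    apply (convex_no_three_collinear K e1 e2 (gamma a) (gamma b) (gamma c)
             (gamma s) (gamma t) (l (gamma b))); try easy.
    + apply Hbd; lra.
    + apply Hbd; lra.
    + apply Hbd; lra.
    + intros E; apply Hinj in E; lra.
    + intros E; apply Hinj in E; lra.
    + intros E; apply Hinj in E; lra.
    + exact (proj1 (Hbd s Hs2)).
    + exact (proj1 (Hbd t Ht2)).
  - exists G; split.
    + intros x y hx hxy hy; specialize (HG1 x y hx hxy hy).
      rewrite !Efx in HG1 by lra; unfold l in HG1.
      replace (_ + _) with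
        (e1 * fst (gamma y) + e2 * snd (gamma y) - (e1 * fst (gamma x) + e2 * snd (gamma x)))
        by ring; easy.
    + assert (f t - f s <= d); [|lra].
      rewrite !Efx by easy.
      eapply Rle_trans; [apply Rle_abs|]; eapply Rle_trans; [apply Hl|].
      apply Hd; apply Hbd; easy.
Qed.

(** [G] stands in for the arc length function. Each of the two coordinates contributes 3d. *)
Lemma boundary_rectifiable (K : Cx -> Prop) gamma d :
  convex_domain K -> boundary_param K gamma -> diameter K d ->
  exists G : R -> R, (forall x y, 0 <= x -> x <= y -> y <= 1 ->
    Cmod (Csub (gamma y) (gamma x)) <= G y - G x) /\ G 1 - G 0 <= 6 * d.
Proof.
  intros HK Hg Hd.
  destruct (coordinate_variation K gamma d 1 0 HK Hg Hd ltac:(lra)) as [G1 [H1 B1]].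
  destruct (coordinate_variation K gamma d 0 1 HK Hg Hd ltac:(lra)) as [G2 [H2 B2]].
  exists (fun x => G1 x + G2 x); split; [|lra]; intros x y hx hxy hy.
  specialize (H1 x y hx hxy hy); specialize (H2 x y hx hxy hy).
  eapply Rle_trans; [apply Cmod_le_abs|].
  unfold Csub, Cadd, Copp; cbn [fst snd].
  replace (1 * _ + _) with (fst (gamma y) + - fst (gamma x)) in H1 by ring.
  replace (0 * _ + _) with (snd (gamma y) + - snd (gamma x)) in H2 by ring.
  lra.
Qed.

Lemma fine_partition_mono t m del : fine_partition t m del ->
  forall j k, (j <= k <= m)%nat -> t j <= t k.
Proof.
  intros (_ & _ & H) j k [hj hk]; induction hj as [|k hj IH]; [lra|].
  specialize (IH ltac:(lia)); pose proof (H k ltac:(lia)); lra.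
Qed.

Lemma fine_partition_bound t m del k : fine_partition t m del -> (k <= m)%nat ->
  0 <= t k <= 1.
Proof.
  intros H hk; pose proof (fine_partition_mono _ _ _ H) as Hm.
  destruct H as (<- & <- & _); split; apply Hm; lia.
Qed.

Lemma rsum_le f g m : (forall k, (k < m)%nat -> f k <= g k) -> rsum f m <= rsum g m.
Proof.
  induction m as [|m IH]; cbn; intros H; [lra|].
  apply Rplus_le_compat; [apply IH; intros; apply H; lia|apply H; lia].
Qed.

Lemma rsum_scal c f m : rsum (fun k => c * f k) m = c * rsum f m.
Proof. induction m as [|m IH]; cbn; [|rewrite IH]; ring. Qed.

Lemma rsum_plus f g m : rsum (fun k => f k + g k) m = rsum f m + rsum g m.
Proof. induction m as [|m IH]; cbn; [|rewrite IH]; ring. Qed.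

Lemma rsum_telescope (f : nat -> R) m : rsum (fun k => f (S k) - f k) m = f m - f O.
Proof. induction m as [|m IH]; cbn; [|rewrite IH]; ring. Qed.

Lemma polygon_length (K : Cx -> Prop) gamma d t m del :
  convex_domain K -> boundary_param K gamma -> diameter K d -> fine_partition t m del ->
  rsum (fun k => Cmod (Csub (gamma (t (S k))) (gamma (t k)))) m <= 6 * d.
Proof.
  intros HK Hg Hd Ht.
  destruct (boundary_rectifiable K gamma d HK Hg Hd) as [G [HG HB]].
  eapply Rle_trans; [apply rsum_le with (g := fun k => G (t (S k)) - G (t k))|].
  - intros k hk; pose proof (fine_partition_bound _ _ _ k Ht ltac:(lia)).
    pose proof (fine_partition_bound _ _ _ (S k) Ht ltac:(lia)).
    pose proof (fine_partition_mono _ _ _ Ht k (S k) ltac:(lia)).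
    apply HG; lra.
  - rewrite (rsum_telescope (fun k => G (t k))).
    destruct Ht as (-> & -> & _); easy.
Qed.

Lemma fine_partition_exists del : 0 < del -> exists t m, fine_partition t m del.
Proof.
  intros Hdel; destruct (archimed_cor1 del Hdel) as [N [HN1 HN2]].
  exists (fun k => INR k / INR N), N.
  assert (0 < INR N) by (apply lt_0_INR; easy).
  split; [cbn; field; lra|split; [field; lra|]].
  intros k _; rewrite S_INR.
  assert ((INR k + 1) / INR N - INR k / INR N = / INR N) by (field; lra).
  assert (0 < / INR N) by (apply Rinv_0_lt_compat; easy); lra.
Qed.

(** * Growth along a normal *)

Fixpoint fwd_diff (delta : R) (j : nat) (q : R -> Cx) (t : R) : Cx :=
  match j with
  | O => q t
  | S i => Csub (fwd_diff delta i q (t + delta)) (fwd_diff delta i q t)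
  end.

(** Discrete Leibniz rule; only two terms survive because the second differences of the linear
    factor 1 - s v vanish. *)
Lemma fwd_diff_linear_factor delta v q j t :
  fwd_diff delta (S j) (fun s => Cmul (Csub C1 (Cscal s v)) (q s)) t =
  Csub (Cmul (Csub C1 (Cscal (t + INR (S j) * delta) v)) (fwd_diff delta (S j) q t))
       (Cmul (Cscal (INR (S j) * delta) v) (fwd_diff delta j q t)).
Proof.
  revert t; induction j as [|j IH]; intros t.
  - cbn [fwd_diff]; set (X := q (t + delta)); set (Y := q t).
    unfold Csub, Cadd, Cmul, Copp, Cscal, C1; apply Cx_ext; cbn [fst snd INR]; ring.
  - change (fwd_diff delta (S (S j)) ?f t) with
      (Csub (fwd_diff delta (S j) f (t + delta)) (fwd_diff delta (S j) f t)).
    rewrite !IH.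
    change (fwd_diff delta (S j) q t) with
      (Csub (fwd_diff delta j q (t + delta)) (fwd_diff delta j q t)).
    set (X := fwd_diff delta (S j) q (t + delta)).
    set (Y := fwd_diff delta j q (t + delta)); set (Z := fwd_diff delta j q t).
    rewrite (S_INR (S j)); set (k := INR (S j)).
    unfold Csub, Cadd, Cmul, Copp, Cscal, C1; apply Cx_ext; cbn [fst snd]; ring.
Qed.

Fixpoint lin_prod (vs : list Cx) (t : R) : Cx :=
  match vs with
  | nil => C1
  | v :: l => Cmul (Csub C1 (Cscal t v)) (lin_prod l t)
  end.

(** The two claims need a joint induction: the vanishing of the next difference kills the first
    Leibniz term, and the second multiplies the old value by (m + 1) [delta] |v|, m being the old
    number of factors. *)
Lemma fwd_diff_lin_prod delta vs :
  0 <= delta ->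
  (forall t, Cmod (fwd_diff delta (length vs) (lin_prod vs) t) =
    INR (fact (length vs)) * delta ^ length vs *
    fold_right Rmult 1 (map Cmod vs)) /\
  (forall t, fwd_diff delta (S (length vs)) (lin_prod vs) t = C0).
Proof.
  intros Hd; induction vs as [|v l [IH1 IH2]].
  - split; intros t; cbn; [rewrite Cmod_1|]; ring.
  - assert (forall j t, fwd_diff delta (S j) (lin_prod (v :: l)) t =
      Csub (Cmul (Csub C1 (Cscal (t + INR (S j) * delta) v)) (fwd_diff delta (S j) (lin_prod l) t))
       (Cmul (Cscal (INR (S j) * delta) v) (fwd_diff delta j (lin_prod l) t))) as E
      by (intros; apply fwd_diff_linear_factor).
    cbn [length map fold_right]; split; intros t.
    + rewrite E, IH2.
      replace (Csub _ _) with (Copp (Cmul (Cscal (INR (S (length l)) * delta) v)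
        (fwd_diff delta (length l) (lin_prod l) t))) by ring.
      rewrite Cmod_opp, Cmod_mul, IH1, Cmod_scal, Rabs_pos_eq
        by (apply Rmult_le_pos; [apply pos_INR|easy]).
      rewrite fact_simpl, mult_INR; cbn [pow]; ring.
    + rewrite E, IH2.
      replace (fwd_diff delta (S (S (length l))) (lin_prod l) t) with C0; [ring|].
      cbn [fwd_diff] in *; rewrite !IH2; ring.
Qed.

Lemma fwd_diff_lt delta q B j t :
  (forall i, (i <= j)%nat -> Cmod (q (t + INR i * delta)) < B) ->
  Cmod (fwd_diff delta j q t) < 2 ^ j * B.
Proof.
  revert t; induction j as [|j IH]; intros t H; cbn [fwd_diff pow].
  - specialize (H O ltac:(lia)); cbn [INR] in H.
    replace (t + 0 * delta) with t in H by ring; lra.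
  - unfold Csub; eapply Rle_lt_trans; [apply Cmod_triangle|]; rewrite Cmod_opp.
    assert (Cmod (fwd_diff delta j q t) < 2 ^ j * B) by (apply IH; intros; apply H; lia).
    assert (Cmod (fwd_diff delta j q (t + delta)) < 2 ^ j * B); [|lra].
    apply IH; intros i hi; specialize (H (S i) ltac:(lia)); rewrite S_INR in H.
    replace (t + delta + INR i * delta) with (t + (INR i + 1) * delta) by ring; easy.
Qed.

Lemma exp_le x y : x <= y -> exp x <= exp y.
Proof. intros [h| ->]; [left; apply exp_increasing, h|lra]. Qed.

Lemma exp_mul_INR n x : exp (INR n * x) = exp x ^ n.
Proof.
  induction n as [|n IH]; [cbn; rewrite Rmult_0_l; apply exp_0|].
  rewrite S_INR; replace ((INR n + 1) * x) with (x + INR n * x) by ring.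
  rewrite exp_plus, IH; reflexivity.
Qed.

(** The induction step is (1 + 1/m)^m <= e <= 3. *)
Lemma pow_self_le_fact m : INR m ^ m <= 3 ^ m * INR (fact m).
Proof.
  induction m as [|m IH]; [cbn; lra|].
  rewrite fact_simpl, mult_INR; cbn [pow].
  set (a := INR (S m)); assert (0 < a) by apply lt_0_INR, Nat.lt_0_succ.
  assert (a ^ m <= 3 * INR m ^ m) as H3.
  { destruct m as [|m']; [cbn; lra|].
    set (m := S m') in *; assert (0 < INR m) by apply lt_0_INR, Nat.lt_0_succ.
    replace a with (INR m * (1 + / INR m)) by (unfold a; rewrite S_INR; field; lra).
    rewrite Rpow_mult_distr, Rmult_comm; apply Rmult_le_compat_r; [apply pow_le; lra|].
    assert (0 < / INR m) by (apply Rinv_0_lt_compat; easy).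
    apply Rle_trans with (exp (/ INR m) ^ m).
    - apply pow_incr; split; [lra|]; apply exp_ineq1_le.
    - rewrite <- exp_mul_INR, Rinv_r by lra; apply exp_le_3. }
  apply Rle_trans with (a * (3 * INR m ^ m)); [apply Rmult_le_compat_l; lra|].
  replace (3 * 3 ^ m * (a * INR (fact m))) with (a * (3 * (3 ^ m * INR (fact m)))) by ring.
  apply Rmult_le_compat_l; lra.
Qed.

(* The m-th difference of a polynomial of degree m is m! times its leading coefficient times
   the m-th power of the step, so the polynomial is large at one of the m + 1 nodes. *)
Lemma lin_prod_large vs d h : 0 < d -> 0 < h -> (forall v, In v vs -> / d <= Cmod v) ->
  exists t, h / 2 <= t <= h /\ (h / (12 * d)) ^ length vs <= Cmod (lin_prod vs t).
Proof.
  intros Hd Hh Hv; set (m := length vs).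
  destruct (Nat.eq_dec m 0) as [E|N].
  { exists h; split; [lra|]; unfold m in *; rewrite E; destruct vs; [|discriminate].
    cbn; rewrite Cmod_1; lra. }
  assert (0 < INR m) as Hm by (apply lt_0_INR; lia).
  (* With this step the m + 1 nodes h/2 + i [delta] run from h/2 to h. *)
  set (delta := h / 2 / INR m).
  assert (0 < delta) as Hdelta by (apply Rdiv_lt_0_compat; lra).
  assert ((/ d) ^ m <= fold_right Rmult 1 (map Cmod vs)) as Hlead.
  { unfold m; clear - Hd Hv; induction vs as [|v l IH]; cbn; [lra|].
    assert (0 < / d) by (apply Rinv_0_lt_compat; easy).
    apply Rmult_le_compat; [lra|apply pow_le; lra|apply Hv; left; easy|].
    apply IH; intros; apply Hv; right; easy. }
  apply NNPP; intros Hno.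
  assert (forall i, (i <= m)%nat ->
    Cmod (lin_prod vs (h / 2 + INR i * delta)) < (h / (12 * d)) ^ m) as Hall.
  { intros i hi; apply Rnot_le_lt; intros hle; apply Hno.
    exists (h / 2 + INR i * delta); split; [|easy].
    pose proof (pos_INR i); apply le_INR in hi.
    assert (INR m * delta = h / 2) by (unfold delta; field; lra).
    assert (0 <= INR i * delta <= INR m * delta) by nra; lra. }
  apply fwd_diff_lt in Hall.
  unfold m in Hall at 1; rewrite (proj1 (fwd_diff_lin_prod delta vs ltac:(lra))) in Hall.
  fold m in Hall.
  assert (0 < INR (fact m)) as Hf by apply INR_fact_lt_0.
  assert (0 < delta ^ m) by (apply pow_lt; easy).
  assert (INR (fact m) * delta ^ m * (/ d) ^ m < 2 ^ m * (h / (12 * d)) ^ m) as Hlt.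
  { eapply Rle_lt_trans; [|exact Hall]; apply Rmult_le_compat_l; [nra|easy]. }
  (* Origin of 12 = 3 * 2 * 2: the factor 3 is lost in m! >= (m/3)^m, one 2 because the nodes span
     an interval of length h/2, and the other 2 in bounding an m-th difference by 2^m values. *)
  apply (Rlt_irrefl (2 ^ m * (h / (12 * d)) ^ m)); eapply Rle_lt_trans; [|exact Hlt].
  pose proof (pow_self_le_fact m) as Hfac.
  replace (2 ^ m * (h / (12 * d)) ^ m) with
    (INR m ^ m * ((delta / 3) ^ m * (/ d) ^ m)).
  - replace (INR (fact m) * delta ^ m * (/ d) ^ m) with
      (3 ^ m * INR (fact m) * ((delta / 3) ^ m * (/ d) ^ m)).
    + apply Rmult_le_compat_r; [|easy].
      apply Rmult_le_pos; apply pow_le; [lra|left; apply Rinv_0_lt_compat; easy].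
    + replace (delta ^ m) with (3 ^ m * (delta / 3) ^ m); [ring|].
      rewrite <- Rpow_mult_distr; f_equal; field.
  - rewrite <- !Rpow_mult_distr; f_equal; unfold delta; field; lra.
Qed.

Lemma lin_prod_growth vs t g : 0 <= g ->
  (forall v, In v vs -> g <= Cmod (Csub C1 (Cscal t v))) ->
  g ^ length vs <= Cmod (lin_prod vs t).
Proof.
  intros Hg; induction vs as [|v l IH]; intros Hv; cbn; [rewrite Cmod_1; lra|].
  rewrite Cmod_mul; apply Rmult_le_compat; [easy|apply pow_le; easy|apply Hv; left; easy|].
  apply IH; intros; apply Hv; right; easy.
Qed.

Definition re_sum (vs : list Cx) : R := fold_right Rplus 0 (map Cre vs).

(** The last clause is Markov's inequality: each member of [bs] has real part above [theta], and the
    other real parts are nonnegative. *)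
Lemma lin_prod_split vs theta : (forall v, In v vs -> 0 <= Cre v) ->
  exists gs bs, (length gs + length bs = length vs)%nat /\
    (forall t, Cmod (lin_prod vs t) = Cmod (lin_prod gs t) * Cmod (lin_prod bs t)) /\
    (forall v, In v gs -> In v vs /\ Cre v <= theta) /\
    (forall v, In v bs -> In v vs) /\ INR (length bs) * theta <= re_sum vs.
Proof.
  unfold re_sum; induction vs as [|v l IH]; intros Hv.
  - exists nil, nil; cbn; split; [easy|split; [|split; [easy|split; [easy|lra]]]].
    intros t; rewrite Cmod_1; ring.
  - destruct IH as (gs & bs & E & Hp & Hg & Hb & Hs).
    { intros; apply Hv; right; easy. }
    pose proof (Hv v (or_introl eq_refl)) as Hv0.
    destruct (Rle_dec (Cre v) theta) as [h|h].
    + exists (v :: gs), bs; cbn [length lin_prod map fold_right].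
      split; [lia|split; [|split; [|split]]].
      * intros t; rewrite !Cmod_mul, Hp; ring.
      * intros w [<-|Hw]; [split; [left|]; easy|split; [right|]; apply Hg, Hw].
      * intros w Hw; right; apply Hb, Hw.
      * lra.
    + exists gs, (v :: bs); cbn [length lin_prod map fold_right].
      split; [lia|split; [|split; [|split]]].
      * intros t; rewrite !Cmod_mul, Hp; ring.
      * intros w Hw; split; [right|]; apply Hg, Hw.
      * intros w [<-|Hw]; [left; easy|right; apply Hb, Hw].
      * rewrite S_INR; lra.
Qed.

(** Expanding, |1 - t v|^2 >= 1 + t (t - h/4)/d^2 >= 1 + y with y = (h/d)^2/8 <= 1/8. Then 1 + y >=
    e^{y/(1+y)} >= e^{8y/9}, and the square root leaves e^{4y/9}. *)
Lemma linear_factor_growth v t d h : 0 < h <= d -> h / 2 <= t <= h ->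
  / d <= Cmod v -> Cre v <= h / (8 * d ^ 2) ->
  exp ((h / d) ^ 2 / 18) <= Cmod (Csub C1 (Cscal t v)).
Proof.
  intros Hh Ht Hv Hre.
  set (y := (h / d) ^ 2 / 8).
  assert (0 < h / d <= 1) as Hx.
  { split; [apply Rdiv_lt_0_compat; lra|].
    apply Rmult_le_reg_r with d; [lra|]; unfold Rdiv; rewrite Rmult_assoc, Rinv_l; lra. }
  assert (0 < y <= / 8) as Hy by (unfold y; split; nra).
  assert (1 + y <= Cmod (Csub C1 (Cscal t v)) * Cmod (Csub C1 (Cscal t v))) as Hsq.
  { rewrite Cmod_sqr; unfold Csub, Cadd, Copp, Cscal, C1; cbn [fst snd].
    assert (/ d * / d <= fst v * fst v + snd v * snd v) as Hv2.
    { rewrite <- Cmod_sqr; assert (0 < / d) by (apply Rinv_0_lt_compat; lra).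
      apply Rmult_le_compat; lra. }
    unfold Cre in Hre.
    assert (t * (t * (/ d * / d)) <= t * (t * (fst v * fst v + snd v * snd v)))
      by (repeat apply Rmult_le_compat_l; lra).
    assert (t * fst v <= t * (h / (8 * d ^ 2))) by (apply Rmult_le_compat_l; lra).
    assert (t * (t * (/ d * / d)) - 2 * (t * (h / (8 * d ^ 2))) >= y) as Hm.
    { replace y with (h / 2 * (h / 4) * (/ d * / d)) by (unfold y; field; lra).
      replace (_ - _) with (t * (t - h / 4) * (/ d * / d)) by (field; lra).
      apply Rle_ge, Rmult_le_compat_r;
        [left; apply Rmult_lt_0_compat; apply Rinv_0_lt_compat; lra|].
      apply Rmult_le_compat; lra. }
    lra. }
  apply Rle_of_sqr; [apply Cmod_ge0|]; eapply Rle_trans; [|exact Hsq].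
  rewrite <- exp_plus; fold y.
  replace ((h / d) ^ 2 / 18 + (h / d) ^ 2 / 18) with (8 / 9 * y) by (unfold y; field; lra).
  apply Rle_trans with (exp (y / (1 + y))).
  - apply exp_le.
    apply Rmult_le_reg_r with (1 + y); [lra|].
    replace (y / (1 + y) * (1 + y)) with y by (field; lra); nra.
  - pose proof (exp_ineq1_le (- (y / (1 + y)))) as He.
    replace (1 + - (y / (1 + y))) with (/ (1 + y)) in He by (field; lra).
    rewrite exp_Ropp in He.
    apply Rinv_le_contravar in He; [|apply Rinv_0_lt_compat; lra].
    rewrite !Rinv_inv in He; easy.
Qed.

(* Factors with small real part grow on [h/2, h]; the others are few, and at some point of the
   interval their product is not too small. *)
Lemma lin_prod_exponential vs d h : 0 < h <= d ->
  (forall v, In v vs -> 0 <= Cre v /\ / d <= Cmod v) ->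
  re_sum vs <= INR (length vs) * ((h / d) ^ 4 / (1500 * d)) ->
  exists t, h / 2 <= t <= h /\
    exp ((h / d) ^ 2 / 36 * INR (length vs)) <= Cmod (lin_prod vs t).
Proof.
  intros Hh Hv Hsum; set (x := h / d) in *.
  assert (0 < x <= 1) as Hx.
  { unfold x; split; [apply Rdiv_lt_0_compat; lra|].
    apply Rmult_le_reg_r with d; [lra|]; unfold Rdiv; rewrite Rmult_assoc, Rinv_l; lra. }
  destruct (lin_prod_split vs (h / (8 * d ^ 2))) as (gs & bs & El & Hp & Hg & Hb & Hs).
  { intros v hv; apply Hv, hv. }
  destruct (lin_prod_large bs d h) as [t [Ht Hbad]]; try lra.
  { intros v hv; apply Hv, Hb, hv. }
  exists t; split; [easy|]; rewrite Hp.
  assert (exp (x ^ 2 / 18) ^ length gs <= Cmod (lin_prod gs t)) as Hgood.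
  { apply lin_prod_growth; [left; apply exp_pos|]; intros v hv.
    destruct (Hg v hv) as [hv1 hv2]; unfold x; apply linear_factor_growth; try easy.
    apply Hv, hv1. }
  (* The loss x/12 per factor is put in exponential form for comparison with the gain. For z = 5/x
     >= 5, e^z >= (1 + z/2)^2 >= 12z/5 = 12/x. *)
  assert (exp (- (5 / x)) ^ length bs <= Cmod (lin_prod bs t)) as Hbad'.
  { eapply Rle_trans; [|exact Hbad]; apply pow_incr; split; [left; apply exp_pos|].
    set (z := 5 / x).
    assert (5 <= z) as Hz.
    { unfold z; apply Rmult_le_reg_r with x; [lra|].
      replace (5 / x * x) with 5 by (field; lra); lra. }
    assert (12 / 5 * z <= exp z) as He.
    { replace z with (z / 2 + z / 2) at 2 by field; rewrite exp_plus.
      pose proof (exp_ineq1_le (z / 2)).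
      apply Rle_trans with ((1 + z / 2) * (1 + z / 2)); [nra|].
      apply Rmult_le_compat; lra. }
    rewrite exp_Ropp.
    replace (h / (12 * d)) with (/ (12 / 5 * z)) by (unfold z, x; field; lra).
    apply Rinv_le_contravar; lra. }
  eapply Rle_trans; [|apply Rmult_le_compat; [| |exact Hgood|exact Hbad']];
    try (apply pow_le; left; apply exp_pos).
  rewrite <- !exp_mul_INR, <- exp_plus; apply exp_le.
  rewrite <- El in *; rewrite plus_INR in *.
  set (g := INR (length gs)) in *; set (m := INR (length bs)) in *.
  assert (0 <= g) by apply pos_INR; assert (0 <= m) by apply pos_INR.
  (* The bound on the sum of real parts is divided by the threshold x/(8d); 375/2 is 1500/8. *)
  assert (m <= (g + m) * (x ^ 3 / (375 / 2))) as Hm.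
  { apply Rmult_le_reg_r with (h / (8 * d ^ 2)); [apply Rdiv_lt_0_compat; nra|].
    eapply Rle_trans; [exact Hs|]; eapply Rle_trans; [exact Hsum|].
    right; unfold x; field; lra. }
  (* The exceptional factors may consume half of the full gain x^2/18 per factor. This is where 1500
     is determined: since 5 + 1/18 <= 46/9, the fraction used is 92/3375, just below 1/36. *)
  assert (m * (5 / x + x ^ 2 / 18) <= (g + m) * (x ^ 2 / 36)); [|nra].
  apply Rle_trans with (m * (46 / 9 / x)).
  { apply Rmult_le_compat_l; [easy|].
    apply Rmult_le_reg_r with x; [lra|].
    replace ((5 / x + x ^ 2 / 18) * x) with (5 + x * x * x / 18) by (field; lra).
    replace (46 / 9 / x * x) with (46 / 9) by (field; lra).
    assert (x * x * x <= 1 * 1 * 1) by (repeat apply Rmult_le_compat; nra); lra. }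
  apply Rle_trans with ((g + m) * (x ^ 3 / (375 / 2)) * (46 / 9 / x)).
  { apply Rmult_le_compat_r; [left; repeat apply Rdiv_lt_0_compat; lra|easy]. }
  replace ((g + m) * (x ^ 3 / (375 / 2)) * (46 / 9 / x)) with
    ((g + m) * (x ^ 2 * (92 / 3375))) by (field; lra).
  apply Rmult_le_compat_l; [lra|]; nra.
Qed.

(** * The comparison on the boundary *)

(* The number v with (zeta - z) v = nu, so that (zeta - t nu) - z = (zeta - z)(1 - t v). *)
Definition normal_quotient (zeta nu z : Cx) : Cx :=
  Cscal (/ (Cmod (Csub zeta z) * Cmod (Csub zeta z))) (Cmul nu (Cconj (Csub zeta z))).

Lemma normal_quotient_mul zeta nu z : 0 < Cmod (Csub zeta z) ->
  Cmul (Csub zeta z) (normal_quotient zeta nu z) = nu.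
Proof.
  intros H; unfold normal_quotient; set (u := Csub zeta z) in *.
  pose proof (Cmod_sqr u) as E; assert (0 < fst u * fst u + snd u * snd u) by nra.
  rewrite E; unfold Cmul, Cscal, Cconj; apply Cx_ext; cbn [fst snd]; field; lra.
Qed.

Lemma root_prod_along_normal zeta nu zs t :
  (forall z, In z zs -> 0 < Cmod (Csub zeta z)) ->
  root_prod zs (Cadd zeta (Cscal (- t) nu)) =
  Cmul (root_prod zs zeta) (lin_prod (map (normal_quotient zeta nu) zs) t).
Proof.
  induction zs as [|z l IH]; intros H; cbn; [ring|].
  rewrite IH by (intros; apply H; right; easy).
  set (v := normal_quotient zeta nu z).
  replace (Csub (Cadd zeta (Cscal (- t) nu)) z) with
    (Cmul (Csub zeta z) (Csub C1 (Cscal t v))); [ring|].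
  rewrite <- (normal_quotient_mul zeta nu z) by (apply H; left; easy); fold v.
  set (u := Csub zeta z); replace (Csub (Cadd zeta _) z) with
    (Cadd u (Cscal (- t) (Cmul u v))) by (unfold u; ring).
  unfold Csub, Cmul, Cscal, Copp, Cadd, C1; apply Cx_ext; cbn [fst snd]; ring.
Qed.

Lemma root_prod_log_deriv zeta nu zs :
  (forall z, In z zs -> 0 < Cmod (Csub zeta z)) ->
  Cmul (root_prod_deriv zs zeta) nu =
  Cmul (root_prod zs zeta) (fold_right Cadd C0 (map (normal_quotient zeta nu) zs)).
Proof.
  induction zs as [|z l IH]; intros H; cbn; [ring|].
  set (v := normal_quotient zeta nu z).
  transitivity (Cadd (Cmul (root_prod l zeta) nu)
    (Cmul (Csub zeta z) (Cmul (root_prod_deriv l zeta) nu))); [ring|].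
  rewrite IH by (intros; apply H; right; easy).
  rewrite <- (normal_quotient_mul zeta nu z) at 1 by (apply H; left; easy); fold v; ring.
Qed.

Lemma re_sum_Cre vs : re_sum vs = Cre (fold_right Cadd C0 vs).
Proof. unfold re_sum; induction vs as [|v l IH]; cbn; [|rewrite IH]; reflexivity. Qed.

Lemma small_deriv_growth (K : Cx -> Prop) zeta nu zs d h :
  diameter K d -> K zeta -> outer_normal K zeta nu -> 0 < h <= d ->
  (forall t, 0 <= t <= h -> K (Cadd zeta (Cscal (- t) nu))) ->
  (forall z, In z zs -> K z) ->
  Cmod (root_prod_deriv zs zeta) <
    (h / d) ^ 4 / (1500 * d) * INR (length zs) * Cmod (root_prod zs zeta) ->
  exists w, K w /\
    exp ((h / d) ^ 2 / 36 * INR (length zs)) * Cmod (root_prod zs zeta)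
      <= Cmod (root_prod zs w).
Proof.
  intros [Hd _] Kz (_ & Hnu & Hn) Hh Hchord Hzs Hsmall.
  set (c := (h / d) ^ 4 / (1500 * d)) in *.
  (* The strict inequality in [Hsmall] excludes p(zeta) = 0, so the quotients nu/(zeta - z_k) make
     sense. *)
  assert (0 < Cmod (root_prod zs zeta)) as Hp.
  { destruct (Cmod_ge0 (root_prod zs zeta)) as [H|H]; [easy|].
    rewrite <- H, Rmult_0_r in Hsmall; pose proof (Cmod_ge0 (root_prod_deriv zs zeta)); lra. }
  assert (forall z, In z zs -> 0 < Cmod (Csub zeta z)) as Hne.
  { intros z hz; destruct (Cmod_ge0 (Csub zeta z)) as [H|H]; [easy|].
    symmetry in H; apply Cmod_eq0 in H.
    replace zeta with (Cadd (Csub zeta z) z) in Hp by ring.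
    rewrite H in Hp; replace (Cadd C0 z) with z in Hp by ring.
    rewrite root_prod_eq0, Cmod_0 in Hp by easy; lra. }
  set (vs := map (normal_quotient zeta nu) zs).
  destruct (lin_prod_exponential vs d h Hh) as [t [Ht Hexp]].
  - intros v hv; apply in_map_iff in hv; destruct hv as [z [<- hz]].
    pose proof (Hne z hz) as Hr; set (u := Csub zeta z) in *; unfold normal_quotient; fold u.
    assert (0 < / (Cmod u * Cmod u)) as Hi by (apply Rinv_0_lt_compat; nra).
    split.
    + specialize (Hn z (Hzs z hz)); rewrite Cre_mul_conj in Hn.
      unfold Csub, Cadd, Copp in Hn; cbn [fst snd] in Hn.
      unfold Cre, Cscal, Cmul, Cconj; cbn [fst snd].
      apply Rmult_le_pos; [lra|].
      unfold u, Csub, Cadd, Copp; cbn [fst snd]; lra.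
    + rewrite Cmod_scal, Cmod_mul, Cmod_conj, Hnu, Rabs_pos_eq by lra.
      replace (/ (Cmod u * Cmod u) * (1 * Cmod u)) with (/ Cmod u) by (field; lra).
      apply Rinv_le_contravar; [easy|]; apply Hd; [easy|apply Hzs, hz].
  - unfold vs; rewrite length_map; fold vs; fold c.
    rewrite re_sum_Cre; set (S := fold_right Cadd C0 vs).
    pose proof (root_prod_log_deriv zeta nu zs Hne) as E; fold vs in E; fold S in E.
    apply (f_equal Cmod) in E; rewrite !Cmod_mul, Hnu in E.
    apply Rle_trans with (Cmod S).
    { eapply Rle_trans; [apply Rle_abs|apply abs_fst_le_Cmod]. }
    apply Rmult_le_reg_l with (Cmod (root_prod zs zeta)); [easy|]; lra.
  - exists (Cadd zeta (Cscal (- t) nu)); split; [apply Hchord; lra|].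
    rewrite root_prod_along_normal by easy; fold vs; rewrite Cmod_mul, Rmult_comm.
    unfold vs in Hexp at 1; rewrite length_map in Hexp; fold vs in Hexp.
    apply Rmult_le_compat_l; lra.
Qed.

Lemma normal_point_dist zeta nu t : 0 <= t -> Cmod nu = 1 ->
  Cmod (Csub zeta (Cadd zeta (Cscal (- t) nu))) = t.
Proof.
  intros Ht Hnu.
  replace (Csub zeta _) with (Copp (Cscal (- t) nu)) by ring.
  rewrite Cmod_opp, Cmod_scal, Hnu, Rabs_Ropp, Rabs_pos_eq; lra.
Qed.

(** The depth h is the supremum of the reachable lengths: closedness of K attains it, convexity
    fills the segment, and the normal inequality excludes t > 0. The lemma makes the set of lengths
    in [local_depth] nonempty. *)
Lemma normal_chord_exists (K : Cx -> Prop) zeta nu d :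
  convex_domain K -> diameter K d -> outer_normal K zeta nu ->
  exists h, normal_chord K zeta nu h.
Proof.
  intros (Hc & Hcl & _ & _) [Hd _] ([Kz _] & Hnu & Hn).
  set (E s := 0 <= s /\ K (Cadd zeta (Cscal (- s) nu))).
  assert (E 0) as E0.
  { split; [lra|]; replace (Cadd zeta _) with zeta; [easy|].
    unfold Cadd, Cscal; apply Cx_ext; cbn [fst snd]; ring. }
  destruct (completeness E) as [h [H1 H2]].
  { exists d; intros s [hs Ks]; rewrite <- (normal_point_dist zeta nu s) by easy.
    apply Hd; easy. }
  { exists 0; easy. }
  assert (0 <= h) as Hh by (apply H1, E0).
  assert (K (Cadd zeta (Cscal (- h) nu))) as Kh.
  { apply Hcl; intros eps Heps; apply NNPP; intros Hno.
    assert (h <= h - eps); [|lra]; apply H2; intros s [hs Ks].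
    apply Rnot_lt_le; intros hlt; apply Hno; exists (Cadd zeta (Cscal (- s) nu)).
    split; [easy|].
    replace (Csub _ _) with (Cscal (h - s) nu)
      by (unfold Csub, Cadd, Copp, Cscal; apply Cx_ext; cbn [fst snd]; ring).
    assert (s <= h) by (apply H1; easy).
    rewrite Cmod_scal, Hnu, Rabs_pos_eq; lra. }
  exists h; split; [easy|]; intros t; split.
  - intros Kt; split.
    + destruct (Rle_dec t 0) as [h0|h0]; [|lra].
      assert (- t <= h); [|lra]; apply H1; split; [lra|]; rewrite Ropp_involutive; easy.
    + specialize (Hn _ Kt); rewrite Cre_mul_conj in Hn.
      replace (Csub _ zeta) with (Cscal t nu) in Hn by ring.
      unfold Cscal in Hn; cbn [fst snd] in Hn.
      pose proof (Cmod_sqr nu) as En; rewrite Hnu in En.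
      replace (_ + _) with (t * (fst nu * fst nu + snd nu * snd nu)) in Hn by ring.
      rewrite <- En in Hn; lra.
  - intros [ht1 ht2]; destruct (Req_dec h 0) as [->|N].
    + replace t with (- 0) by lra; apply E0.
    + replace (Cadd zeta (Cscal t nu)) with
        (Cadd (Cscal (1 - - t / h) zeta) (Cscal (- t / h) (Cadd zeta (Cscal (- h) nu)))).
      * apply Hc; try easy; split; [apply Rmult_le_pos; [lra|]|].
        { left; apply Rinv_0_lt_compat; lra. }
        apply Rmult_le_reg_r with h; [lra|].
        replace (- t / h * h) with (- t) by (field; lra); lra.
      * unfold Cadd, Cscal; apply Cx_ext; cbn [fst snd]; field; lra.
Qed.

(** [depth] constrains only those numbers that are a [local_depth], so this least upper bound is
    first shown to exist. As it is at least [hK] > h, some normal chord is longer than h. *)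
Lemma deep_normal (K : Cx -> Prop) hK d zeta h :
  convex_domain K -> depth K hK -> diameter K d -> boundary K zeta -> 0 < h < hK ->
  h <= d /\ exists nu, outer_normal K zeta nu /\
    forall t, 0 <= t <= h -> K (Cadd zeta (Cscal (- t) nu)).
Proof.
  intros HK [HhK _] Hd Hz Hh.
  set (E s := exists nu, outer_normal K zeta nu /\ normal_chord K zeta nu s).
  assert (forall nu s, outer_normal K zeta nu -> normal_chord K zeta nu s -> s <= d) as Hb.
  { intros nu s (_ & Hnu & _) [hs Hs].
    rewrite <- (normal_point_dist zeta nu s) by easy.
    apply Hd; [apply Hz|apply Hs; lra]. }
  destruct (completeness E) as [r Hr].
  { exists d; intros s (nu & H1 & H2); apply (Hb nu); easy. }
  { destruct (outer_normal_exists K zeta HK Hz) as [nu Hnu].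
    destruct (normal_chord_exists K zeta nu d HK Hd Hnu) as [s Hs].
    exists s, nu; easy. }
  assert (hK <= r) as Hle by (apply HhK; exists zeta; split; [easy|exact Hr]).
  assert (exists nu s, outer_normal K zeta nu /\ normal_chord K zeta nu s /\ h < s)
    as (nu & s & H1 & H2 & H3).
  { apply NNPP; intros Hno; assert (r <= h); [|lra].
    apply Hr; intros s (nu & H1 & H2); apply Rnot_lt_le; intros hlt.
    apply Hno; exists nu, s; easy. }
  pose proof (Hb nu s H1 H2); split; [lra|].
  exists nu; split; [easy|]; intros t Ht; apply H2; lra.
Qed.

(** * Riemann sums along the boundary and the final comparison of integrals *)

Lemma param_uniform (K : Cx -> Prop) gamma : boundary_param K gamma ->
  forall eta, 0 < eta -> exists del, 0 < del /\ forall s t,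
    0 <= s <= 1 -> 0 <= t <= 1 -> Rabs (s - t) < del ->
    Cmod (Csub (gamma s) (gamma t)) < eta.
Proof.
  intros (Hcont & _) eta Heta.
  assert (forall l : Cx -> R, (forall z w, Rabs (l z - l w) <= Cmod (Csub z w)) ->
    exists del, 0 < del /\ forall s t, 0 <= s <= 1 -> 0 <= t <= 1 ->
      Rabs (s - t) < del -> Rabs (l (gamma s) - l (gamma t)) < eta / 2) as Hl.
  { intros l Hl.
    assert (0 < eta / 2) as Heta2 by lra.
    destruct (@Heine_cor2 (fun x => l (gamma (clamp x))) 0 1) with
      (eps := mkposreal _ Heta2) as [del Hdel].
    - intros x _ eps Heps.
      destruct (Hcont (clamp x) (clamp_bound x) eps Heps) as [del [Hdel Hc]].
      exists del; split; [easy|]; intros y [_ Hy]; cbn in *; unfold Rdist in *.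
      eapply Rle_lt_trans; [apply Hl|]; apply Hc; [apply clamp_bound|].
      eapply Rle_lt_trans; [apply clamp_contraction|easy].
    - exists del; split; [apply cond_pos|]; intros s t hs ht hst.
      specialize (Hdel s t hs ht hst); cbv beta in Hdel; rewrite !clamp_id in Hdel; easy. }
  destruct (Hl fst) as [d1 [Hd1 H1]].
  { intros z w; apply (abs_fst_le_Cmod (Csub z w)). }
  destruct (Hl snd) as [d2 [Hd2 H2]].
  { intros z w; apply (abs_snd_le_Cmod (Csub z w)). }
  exists (Rmin d1 d2); split; [apply Rmin_pos; easy|]; intros s t hs ht hst.
  specialize (H1 s t hs ht (Rlt_le_trans _ _ _ hst (Rmin_l _ _))).
  specialize (H2 s t hs ht (Rlt_le_trans _ _ _ hst (Rmin_r _ _))).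
  eapply Rle_lt_trans; [apply Cmod_le_abs|].
  change (fst (Csub (gamma s) (gamma t))) with (fst (gamma s) - fst (gamma t)).
  change (snd (Csub (gamma s) (gamma t))) with (snd (gamma s) - snd (gamma t)); lra.
Qed.

Lemma fine_partition_locate t m del s : fine_partition t m del -> 0 <= s <= 1 ->
  exists k, (k < m)%nat /\ t k <= s <= t (S k).
Proof.
  intros (H0 & H1 & Hstep) Hs.
  assert (forall j, (j <= m)%nat -> s <= t j -> (0 < j)%nat ->
    exists k, (k < m)%nat /\ t k <= s <= t (S k)) as H.
  { induction j as [|j IH]; intros hj hs h0; [lia|].
    destruct (Rle_dec s (t j)) as [h|h].
    - destruct j as [|j]; [exists O; split; [lia|split; lra]|apply IH; [lia|easy|lia]].
    - exists j; split; [lia|lra]. }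
  apply (H m); [lia|lra|]; destruct m; [lra|lia].
Qed.

Lemma Cmod_increments (p : nat -> Cx) m :
  Cmod (Csub (p m) (p O)) <= rsum (fun k => Cmod (Csub (p (S k)) (p k))) m.
Proof.
  induction m as [|m IH]; cbn; [rewrite Cmod_sub_self; lra|].
  pose proof (Cmod_sub_triangle (p (S m)) (p m) (p O)); lra.
Qed.

Lemma rsum_mono f j m : (j <= m)%nat -> (forall k, 0 <= f k) -> rsum f j <= rsum f m.
Proof. intros hj Hf; induction hj as [|m hj IH]; cbn; [lra|specialize (Hf m); lra]. Qed.

(** The tangent to y^q at [lam], solved for y. Summed with weights, it gives Hölder's inequality in
    linear form: if the mean of y^q is at most [lam]^q, the mean of y is at most [lam]. *)
Lemma le_rpow_tangent y lam q : 0 <= y -> 0 < lam -> 1 <= q ->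
  y <= (1 - / q) * lam + lam / (q * rpow lam q) * rpow y q.
Proof.
  intros Hy Hlam Hq; pose proof (rpow_gt0 lam q Hlam) as Hg.
  assert (0 <= y / lam) as Hu
    by (apply Rmult_le_pos; [easy|left; apply Rinv_0_lt_compat; easy]).
  pose proof (rpow_bernoulli (y / lam) q Hu Hq) as HB.
  assert (rpow y q = rpow lam q * rpow (y / lam) q) as E.
  { rewrite <- rpow_mult by lra; f_equal; field; lra. }
  rewrite E; apply Rmult_le_reg_r with (q / lam); [apply Rdiv_lt_0_compat; lra|].
  replace (((1 - / q) * lam + lam / (q * rpow lam q) * (rpow lam q * rpow (y / lam) q))
    * (q / lam)) with (q - 1 + rpow (y / lam) q) by (field; lra).
  replace (y * (q / lam)) with (q * (y / lam)) by (field; lra); lra.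
Qed.

(* The right-hand side is Hölder's bound for the integral of |p'|, stated without roots of the
   integral of |p'|^q so that the case where the latter vanishes is included. *)
Lemma boundary_oscillation (K : Cx -> Prop) gamma d q A zs Idp lam s :
  convex_domain K -> boundary_param K gamma -> diameter K d -> 0 < d -> 1 <= q ->
  arc_integral gamma (fun z => rpow (Cmod (Cmul A (root_prod_deriv zs z))) q) Idp ->
  0 < lam -> Idp <= rpow lam q * (6 * d) -> 0 <= s <= 1 ->
  Cmod A * Cmod (Csub (root_prod zs (gamma s)) (root_prod zs (gamma 0))) <= 6 * d * lam.
Proof.
  intros HK Hg Hd Hd0 Hq HI Hlam Hle Hs.
  pose proof HK as (_ & _ & [M HM] & _).
  assert (0 <= M) as HM0.
  { destruct Hg as (_ & _ & _ & Hbd & _).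
    pose proof (HM _ (proj1 (Hbd 0 ltac:(lra)))); pose proof (Cmod_ge0 (gamma 0)); lra. }
  destruct (root_prod_smooth zs M HM0) as [B [HB Hsm]].
  pose proof (Cmod_ge0 A) as HA; pose proof (rpow_gt0 lam q Hlam) as Hpow.
  set (a := lam / (q * rpow lam q)).
  assert (0 < a) as Ha by (apply Rdiv_lt_0_compat; nra).
  apply Rle_plus_epsilon; intros e He.
  (* The error per unit of [eta] is |A| B times 6d for the Taylor remainders along the polygon, plus
     |A| B for the gap between gamma(s) and the preceding node. *)
  set (C := Cmod A * B * (6 * d + 1) + 1).
  assert (0 <= Cmod A * B) by nra; assert (0 < C) by (unfold C; nra).
  destruct (param_uniform K gamma Hg (e / (2 * C))) as [del1 [Hdel1 Hu]].
  { apply Rdiv_lt_0_compat; lra. }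
  destruct (HI (e / (2 * a))) as [del2 [Hdel2 HS]]; [apply Rdiv_lt_0_compat; lra|].
  set (eta := e / (2 * C)) in *.
  assert (0 < eta) as Heta by (apply Rdiv_lt_0_compat; lra).
  destruct (fine_partition_exists (Rmin del1 del2)) as [t [m Ht]];
    [apply Rmin_pos; easy|].
  assert (fine_partition t m del2) as Ht2.
  { destruct Ht as (h0 & h1 & h2); repeat split; try easy; apply h2 in H1; [easy|].
    pose proof (Rmin_r del1 del2); lra. }
  specialize (HS t m Ht2).
  pose proof (polygon_length K gamma d t m _ HK Hg Hd Ht) as HL.
  set (Del k := Cmod (Csub (gamma (t (S k))) (gamma (t k)))) in *.
  set (P := root_prod zs) in *.
  set (g k := Cmod (Cmul A (root_prod_deriv zs (gamma (t k))))).
  assert (forall r, 0 <= r <= 1 -> Cmod (gamma r) <= M) as HgM.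
  { intros r hr; apply HM; destruct Hg as (_ & _ & _ & Hbd & _); apply Hbd, hr. }
  assert (forall k, (k < m)%nat -> Del k < eta) as HDel.
  { intros k hk; apply Hu; try (apply (fine_partition_bound t m _ _ Ht); lia).
    destruct Ht as (_ & _ & h2); destruct (h2 k hk) as [h3 h4].
    rewrite Rabs_pos_eq by lra; pose proof (Rmin_l del1 del2); lra. }
  assert (forall k, (k < m)%nat ->
    Cmod A * Cmod (Csub (P (gamma (t (S k)))) (P (gamma (t k)))) <=
    a * (rpow (g k) q * Del k) + ((1 - / q) * lam + Cmod A * B * eta) * Del k) as Hstep.
  { intros k hk.
    pose proof (HgM _ (fine_partition_bound t m _ k Ht ltac:(lia))) as Hk.
    pose proof (HgM _ (fine_partition_bound t m _ (S k) Ht ltac:(lia))) as HSk.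
    destruct (Hsm _ _ Hk HSk) as (_ & _ & HT).
    specialize (HDel k hk); fold (Del k) in HT; assert (0 <= Del k) as HD by apply Cmod_ge0.
    pose proof (Cmod_le_add (Csub (P (gamma (t (S k)))) (P (gamma (t k))))
      (Cmul (Csub (gamma (t (S k))) (gamma (t k))) (root_prod_deriv zs (gamma (t k))))) as H1.
    rewrite Cmod_mul in H1; fold (Del k) in H1.
    pose proof (le_rpow_tangent (g k) lam q (Cmod_ge0 _) Hlam Hq) as Hy; fold a in Hy.
    assert (g k = Cmod A * Cmod (root_prod_deriv zs (gamma (t k)))) as Eg
      by (unfold g; apply Cmod_mul).
    set (D := Cmod (root_prod_deriv zs (gamma (t k)))) in *.
    assert (B * (Del k * Del k) <= B * (eta * Del k)) by (apply Rmult_le_compat_l; nra).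
    apply Rle_trans with (Cmod A * (Del k * D + B * (eta * Del k)));
      [apply Rmult_le_compat_l; lra|].
    replace (Cmod A * (Del k * D + B * (eta * Del k))) with
      (g k * Del k + Cmod A * B * eta * Del k) by (rewrite Eg; ring).
    apply (Rmult_le_compat_r (Del k)) in Hy; lra. }
  destruct (fine_partition_locate t m _ s Ht Hs) as [k [hk Hks]].
  pose proof (fine_partition_bound t m _ k Ht ltac:(lia)) as Htk.
  assert (Cmod (Csub (gamma s) (gamma (t k))) < eta) as Hsk.
  { apply Hu; try easy; destruct Ht as (_ & _ & h2); destruct (h2 k hk) as [h3 h4].
    rewrite Rabs_pos_eq by lra; pose proof (Rmin_l del1 del2); lra. }
  assert (Cmod A * Cmod (Csub (P (gamma s)) (P (gamma (t k)))) <= Cmod A * B * eta) as H1.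
  { rewrite Rmult_assoc; apply Rmult_le_compat_l; [easy|].
    destruct (Hsm _ _ (HgM _ Htk) (HgM _ Hs)) as (_ & Hlip & _).
    eapply Rle_trans; [exact Hlip|]; apply Rmult_le_compat_l; lra. }
  assert (Cmod A * Cmod (Csub (P (gamma (t k))) (P (gamma 0))) <=
    a * rsum (fun k => rpow (g k) q * Del k) m +
    ((1 - / q) * lam + Cmod A * B * eta) * rsum Del m) as H2.
  { pose proof (Cmod_increments (fun j => P (gamma (t j))) k) as Hinc; cbv beta in Hinc.
    rewrite (proj1 Ht) in Hinc.
    eapply Rle_trans; [apply Rmult_le_compat_l; [easy|exact Hinc]|].
    rewrite <- rsum_scal.
    eapply Rle_trans; [apply rsum_mono with (m := m); [lia|]|].
    { intros j; apply Rmult_le_pos; [easy|apply Cmod_ge0]. }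
    eapply Rle_trans; [apply rsum_le; exact Hstep|].
    rewrite rsum_plus, !rsum_scal; lra. }
  (* The share 1/q of 6 d [lam] comes from the integral of |p'|^q; the constant term of the tangent
     supplies the share 1 - 1/q in [H4]. *)
  assert (a * rsum (fun k => rpow (g k) q * Del k) m <= / q * lam * (6 * d) + e / 2) as H3.
  { apply Rabs_def2 in HS; fold (g) in HS.
    change (fun k => rpow (Cmod (Cmul A (root_prod_deriv zs (gamma (t k))))) q * _)
      with (fun k => rpow (g k) q * Del k) in HS.
    apply Rle_trans with (a * (rpow lam q * (6 * d) + e / (2 * a)));
      [apply Rmult_le_compat_l; lra|].
    right; unfold a; field; lra. }
  assert (0 <= (1 - / q) * lam + Cmod A * B * eta) as Hc0.
  { assert (/ q <= 1) by (rewrite <- Rinv_1; apply Rinv_le_contravar; lra).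
    assert (0 <= (1 - / q) * lam) by (apply Rmult_le_pos; lra).
    assert (0 <= Cmod A * B * eta) by (apply Rmult_le_pos; lra); lra. }
  assert (((1 - / q) * lam + Cmod A * B * eta) * rsum Del m <=
    ((1 - / q) * lam + Cmod A * B * eta) * (6 * d)) as H4
    by (apply Rmult_le_compat_l; easy).
  assert (Cmod A * B * (6 * d + 1) * eta <= e / 2) as H5.
  { apply Rle_trans with (C * eta); [apply Rmult_le_compat_r; unfold C; lra|].
    right; unfold eta; field; lra. }
  pose proof (Rmult_le_compat_l _ _ _ HA
    (Cmod_sub_triangle (P (gamma s)) (P (gamma (t k))) (P (gamma 0)))) as H6.
  lra.
Qed.

Lemma sup_bound_by_deriv (K : Cx -> Prop) gamma d q A zs Idp lam w :
  convex_domain K -> boundary_param K gamma -> diameter K d -> 0 < d -> 1 <= q ->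
  A <> C0 -> zs <> nil -> (forall z, In z zs -> K z) ->
  arc_integral gamma (fun z => rpow (Cmod (Cmul A (root_prod_deriv zs z))) q) Idp ->
  0 < lam -> Idp <= rpow lam q * (6 * d) -> K w ->
  Cmod (Cmul A (root_prod zs w)) <= 12 * d * lam.
Proof.
  intros HK Hg Hd Hd0 Hq HA Hnil Hzs HI Hlam Hle Kw.
  assert (0 < Cmod A) as HA0.
  { destruct (Cmod_ge0 A) as [h|h]; [easy|]; exfalso; apply HA, Cmod_eq0; easy. }
  pose proof HK as (_ & Hcl & Hbd & _).
  assert (forall z, K z ->
    Cmod (Csub (root_prod zs z) (root_prod zs (gamma 0))) <= 6 * d * lam / Cmod A) as Hosc.
  { apply maximum_principle; try easy; intros z bz.
    destruct Hg as (g1 & g2 & g3 & g4 & g5); destruct (g5 z bz) as [s [Hs <-]].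
    apply Rmult_le_reg_l with (Cmod A); [easy|].
    replace (Cmod A * (6 * d * lam / Cmod A)) with (6 * d * lam) by (field; lra).
    apply (boundary_oscillation K gamma d q A zs Idp); easy. }
  destruct zs as [|z1 l]; [easy|]; set (zs := z1 :: l) in *.
  pose proof (Hosc w Kw) as H1; pose proof (Hosc z1 (Hzs z1 (or_introl eq_refl))) as H2.
  assert (root_prod zs z1 = C0) as E by (apply root_prod_eq0; left; easy).
  rewrite E, Cmod_sub_sym in H2.
  pose proof (Cmod_sub_triangle (root_prod zs w) (root_prod zs (gamma 0)) C0) as H3.
  replace (Csub (root_prod zs w) C0) with (root_prod zs w) in H3 by ring.
  rewrite Cmod_mul; replace (12 * d * lam) with
    (Cmod A * (6 * d * lam / Cmod A + 6 * d * lam / Cmod A)) by (field; lra).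
  apply Rmult_le_compat_l; lra.
Qed.

(** Both integrals are compared on one common fine partition; the constant b is summed along the
    polygon, whose length is at most 6d. Dividing by a + 1 covers the case a = 0. *)
Lemma arc_integral_le (K : Cx -> Prop) gamma d f g If Ig a b :
  convex_domain K -> boundary_param K gamma -> diameter K d -> 0 <= a -> 0 <= b ->
  arc_integral gamma f If -> arc_integral gamma g Ig ->
  (forall z, boundary K z -> f z <= a * g z + b) ->
  If <= a * Ig + b * (6 * d).
Proof.
  intros HK Hg Hd Ha Hb HIf HIg Hfg; apply Rle_plus_epsilon; intros e He.
  destruct (HIf (e / 2)) as [d1 [Hd1 H1]]; [lra|].
  destruct (HIg (e / (2 * (a + 1)))) as [d2 [Hd2 H2]]; [apply Rdiv_lt_0_compat; lra|].
  destruct (fine_partition_exists (Rmin d1 d2)) as [t [m Ht]]; [apply Rmin_pos; easy|].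
  assert (forall del, Rmin d1 d2 <= del -> fine_partition t m del) as Hw.
  { intros del hdel; destruct Ht as (h0 & h1 & h2); split; [easy|split; [easy|]].
    intros k hk; destruct (h2 k hk); lra. }
  specialize (H1 t m (Hw _ (Rmin_l _ _))); specialize (H2 t m (Hw _ (Rmin_r _ _))).
  pose proof (polygon_length K gamma d t m _ HK Hg Hd Ht) as HL.
  set (Del k := Cmod (Csub (gamma (t (S k))) (gamma (t k)))) in *.
  assert (rsum (fun k => f (gamma (t k)) * Del k) m <=
    a * rsum (fun k => g (gamma (t k)) * Del k) m + b * rsum Del m) as H3.
  { rewrite <- !rsum_scal, <- rsum_plus; apply rsum_le; intros k hk.
    assert (0 <= Del k) by apply Cmod_ge0.
    destruct Hg as (_ & _ & _ & Hbd & _).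
    pose proof (Hfg _ (Hbd _ (fine_partition_bound t m _ k Ht ltac:(lia)))); nra. }
  apply Rabs_def2 in H1; apply Rabs_def2 in H2.
  assert (b * rsum Del m <= b * (6 * d)) by (apply Rmult_le_compat_l; easy).
  set (X := rsum (fun k => g (gamma (t k)) * Del k) m) in *.
  change (rsum (fun k => g (gamma (t k)) * _) m) with X in H2.
  change (rsum (fun k => f (gamma (t k)) * _) m) with
    (rsum (fun k => f (gamma (t k)) * Del k) m) in H1.
  assert (a * X <= a * (Ig + e / (2 * (a + 1)))) by (apply Rmult_le_compat_l; lra).
  assert (a * (e / (2 * (a + 1))) <= e / 2); [|lra].
  replace (a * (e / (2 * (a + 1)))) with (a / (a + 1) * (e / 2)) by (field; lra).
  assert (a / (a + 1) <= 1); [|nra].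
  apply Rmult_le_reg_r with (a + 1); [lra|].
  replace (a / (a + 1) * (a + 1)) with a by (field; lra); lra.
Qed.

(* 0.9 hK stands for a chord length within reach at every boundary point, since the
   supremum defining the depth need not be attained. *)
Lemma integral_comparison (K : Cx -> Prop) gamma hK d q n a zs Ip Idp lam :
  convex_domain K -> depth K hK -> 0 < hK -> diameter K d -> 1 <= q ->
  boundary_param K gamma -> a <> C0 -> length zs = n -> (0 < n)%nat ->
  (forall z, In z zs -> K z) ->
  arc_integral gamma (fun z => rpow (Cmod (Cmul a (root_prod zs z))) q) Ip ->
  arc_integral gamma (fun z => rpow (Cmod (Cmul a (root_prod_deriv zs z))) q) Idp ->
  0 < lam -> Idp <= rpow lam q * (6 * d) ->
  0 < d /\ Ip <= rpow (lam * (3000 * d ^ 5 / (hK ^ 4 * INR n))) q * (6 * d).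
Proof.
  intros HK Hdepth HhK Hd Hq Hg Ha Hn Hn0 Hzs HIp HIdp Hlam Hle.
  assert (0 < INR n) as HN by (apply lt_0_INR; easy).
  set (h := 9 / 10 * hK); assert (0 < h < hK) as Hh by (unfold h; lra).
  assert (boundary K (gamma 0)) as B0 by (destruct Hg as (_ & _ & _ & H & _); apply H; lra).
  destruct (deep_normal K hK d (gamma 0) h HK Hdepth Hd B0 Hh) as [Hhd _].
  assert (0 < d) as Hd0 by lra; split; [easy|].
  set (x := h / d); set (c := x ^ 4 / (1500 * d) * INR n).
  set (y := x ^ 2 / 36 * INR n).
  assert (0 < x <= 1) as Hx.
  { unfold x; split; [apply Rdiv_lt_0_compat; lra|].
    apply Rmult_le_reg_r with d; [lra|].
    replace (h / d * d) with h by (field; lra); lra. }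
  assert (0 < x ^ 4 /\ 0 < x ^ 2) as [Hx4 Hx2] by (split; apply pow_lt; lra).
  assert (0 < c) as Hc by (unfold c; apply Rmult_lt_0_compat; [apply Rdiv_lt_0_compat|]; lra).
  assert (0 < y) as Hy by (unfold y; nra).
  (* Bounds |p| at the boundary points with |p'| < c |p|: there |p| is at most e^{-y} times its size
     at some point of K, which [sup_bound_by_deriv] controls. *)
  set (E := exp (- y) * (12 * d * lam)).
  assert (0 < exp (- y)) as Hey by apply exp_pos.
  assert (0 <= E) as HE by (unfold E; repeat apply Rmult_le_pos; lra).
  assert (forall z, boundary K z -> rpow (Cmod (Cmul a (root_prod zs z))) q <=
    rpow (/ c) q * rpow (Cmod (Cmul a (root_prod_deriv zs z))) q + rpow E q) as Hpt.
  { intros z bz; rewrite <- rpow_mult;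
      [|left; apply Rinv_0_lt_compat; easy|apply Cmod_ge0].
    set (D := Cmod (Cmul a (root_prod_deriv zs z))).
    pose proof (rpow_ge0 (/ c * D) q); pose proof (rpow_ge0 E q).
    destruct (Rle_lt_dec (c * Cmod (root_prod zs z)) (Cmod (root_prod_deriv zs z)))
      as [Hgood|Hbad].
    - assert (rpow (Cmod (Cmul a (root_prod zs z))) q <= rpow (/ c * D) q); [|lra].
      apply rpow_le; [lra|]; unfold D; rewrite !Cmod_mul.
      apply Rmult_le_reg_l with c; [easy|].
      replace (c * (/ c * (Cmod a * Cmod (root_prod_deriv zs z)))) with
        (Cmod a * Cmod (root_prod_deriv zs z)) by (field; lra).
      pose proof (Rmult_le_compat_l _ _ _ (Cmod_ge0 a) Hgood); lra.
    - assert (rpow (Cmod (Cmul a (root_prod zs z))) q <= rpow E q); [|lra].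
      apply rpow_le; [lra|].
      destruct (deep_normal K hK d z h HK Hdepth Hd bz Hh) as [_ (nu & Hnu & Hchord)].
      destruct (small_deriv_growth K z nu zs d h) as [w [Kw Hw]]; try easy.
      { apply bz. }
      { rewrite Hn; fold x; fold c; easy. }
      rewrite Hn in Hw; fold x in Hw; fold y in Hw.
      pose proof (sup_bound_by_deriv K gamma d q a zs Idp lam w HK Hg Hd Hd0 Hq Ha) as HM.
      specialize (HM ltac:(intros ->; cbn in Hn; lia) Hzs HIdp Hlam Hle Kw).
      unfold E; apply Rle_trans with (exp (- y) * Cmod (Cmul a (root_prod zs w)));
        [|apply Rmult_le_compat_l; lra].
      rewrite !Cmod_mul.
      replace (Cmod a * Cmod (root_prod zs z)) with
        (exp (- y) * (Cmod a * (exp y * Cmod (root_prod zs z)))).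
      + apply Rmult_le_compat_l; [lra|]; apply Rmult_le_compat_l; [apply Cmod_ge0|easy].
      + pose proof (exp_pos y); rewrite exp_Ropp; field; lra. }
  pose proof (arc_integral_le K gamma d _ _ Ip Idp _ _ HK Hg Hd
    (rpow_ge0 (/ c) q) (rpow_ge0 E q) HIp HIdp Hpt) as Hint.
  assert (0 < / c) as Hic by (apply Rinv_0_lt_compat; easy).
  assert (rpow (/ c) q * Idp <= rpow (/ c) q * (rpow lam q * (6 * d))) as H1
    by (apply Rmult_le_compat_l; [apply rpow_ge0|easy]).
  (* The constant 3000 is checked here. With X = d/(x^4 n), 1/c = 1500 X and e^{-y} 12 d <= 12 d/y =
     432 x^2 X <= 432 X, while h = 9/10 [hK] makes X equal to 10000/6561 times d^5/([hK]^4 n); 1932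
     * 10000/6561 is below 2945. *)
  assert (rpow (/ c * lam) q + rpow E q <=
    rpow (lam * (3000 * d ^ 5 / (hK ^ 4 * INR n))) q) as H2.
  { eapply Rle_trans; [apply rpow_superadd; [nra|easy|easy]|].
    apply rpow_le; [lra|].
    replace (/ c * lam + E) with (lam * (/ c + exp (- y) * (12 * d))) by (unfold E; ring).
    apply Rmult_le_compat_l; [lra|].
    assert (exp (- y) <= / y) as H3.
    { rewrite exp_Ropp; apply Rinv_le_contravar; [easy|].
      pose proof (exp_ineq1_le y); lra. }
    assert (exp (- y) * (12 * d) <= / y * (12 * d)) as H4 by (apply Rmult_le_compat_r; lra).
    assert (/ c = 1500 * (d / (x ^ 4 * INR n))) as E1 by (unfold c; field; lra).
    assert (/ y * (12 * d) = 432 * (d / (x ^ 4 * INR n)) * x ^ 2) as E2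
      by (unfold y; field; lra).
    assert (0 < d / (x ^ 4 * INR n)) as H5
      by (apply Rdiv_lt_0_compat; [|apply Rmult_lt_0_compat]; lra).
    assert (d / (x ^ 4 * INR n) = 10000 / 6561 * (d ^ 5 / (hK ^ 4 * INR n))) as E3
      by (unfold x, h; field; lra).
    assert (x ^ 2 <= 1) by nra.
    assert (432 * (d / (x ^ 4 * INR n)) * x ^ 2 <= 432 * (d / (x ^ 4 * INR n)) * 1)
      by (apply Rmult_le_compat_l; lra).
    replace (3000 * d ^ 5 / (hK ^ 4 * INR n)) with (3000 * (d ^ 5 / (hK ^ 4 * INR n)))
      by (field; lra).
    lra. }
  apply (Rmult_le_compat_r (6 * d)) in H2; [|lra].
  rewrite rpow_mult in H2 by lra; lra.
Qed.

Theorem theorem3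
  (K : Cx -> Prop) (hK d q : R) (n : nat) (a : nat -> Cx)
  (gamma : R -> Cx) (Ip Idp : R) :
  convex_domain K ->
  depth K hK -> 0 < hK ->
  diameter K d ->
  1 <= q ->
  in_Pn K n a ->
  boundary_param K gamma ->
  arc_integral gamma (fun z => rpow (Cmod (peval a n z)) q) Ip ->
  arc_integral gamma (fun z => rpow (Cmod (peval_deriv a n z)) q) Idp ->
  rpow Idp (1 / q) >= hK ^ 4 / (3000 * d ^ 5) * INR n * rpow Ip (1 / q).
Proof.
  intros HK Hdepth HhK Hd Hq [Ha Hroots] Hg HIp HIdp; apply Rle_ge.
  pose proof (rpow_ge0 Idp (1 / q)) as Hpos.
  destruct (Nat.eq_dec n 0) as [->|Hn0]; [cbn [INR]; lra|].
  destruct (FundamentalTheorem.factorization n a Ha) as (zs & Hlen & Hfac).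
  assert (forall z, peval a n z = Cmul (a n) (root_prod zs z)) as E1 by apply Hfac.
  assert (forall z, peval_deriv a n z = Cmul (a n) (root_prod_deriv zs z)) as E2
    by apply Hfac.
  assert (forall z, In z zs -> K z) as Hzs.
  { intros z hz; apply Hroots; rewrite E1, root_prod_eq0 by easy; ring. }
  (* Pointwise equality of integrands suffices, so the factored forms can be substituted without
     functional extensionality. *)
  assert (forall f g I, (forall z, f z = g z) -> arc_integral gamma f I ->
    arc_integral gamma g I) as Hext.
  { intros f g I E HI eps Heps; destruct (HI eps Heps) as [del [Hdel H]].
    exists del; split; [easy|]; intros t m Ht; specialize (H t m Ht).
    replace (rsum (fun k => g (gamma (t k)) * _) m) with
      (rsum (fun k => f (gamma (t k)) * Cmod (Csub (gamma (t (S k))) (gamma (t k)))) m);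
      [easy|].
    apply Rle_antisym; apply rsum_le; intros; rewrite E; lra. }
  apply (Hext _ (fun z => rpow (Cmod (Cmul (a n) (root_prod zs z))) q)) in HIp;
    [|intros; rewrite E1; easy].
  apply (Hext _ (fun z => rpow (Cmod (Cmul (a n) (root_prod_deriv zs z))) q)) in HIdp;
    [|intros; rewrite E2; easy].
  assert (forall lam, 0 < lam -> Idp <= rpow lam q * (6 * d) ->
    0 < d /\ Ip <= rpow (lam * (3000 * d ^ 5 / (hK ^ 4 * INR n))) q * (6 * d)) as Hmain.
  { intros lam Hlam Hle.
    apply (integral_comparison K gamma hK d q n (a n) zs Ip Idp lam); try easy; lia. }
  assert (0 < INR n) as HN by (apply lt_0_INR; lia).
  assert (boundary K (gamma 0)) as B0 by (destruct Hg as (_ & _ & _ & H & _); apply H; lra).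
  assert (0 < d) as Hd0.
  { destruct (deep_normal K hK d (gamma 0) (hK / 2) HK Hdepth Hd B0); lra. }
  set (C := 3000 * d ^ 5 / (hK ^ 4 * INR n)) in *.
  assert (0 < d ^ 5 /\ 0 < hK ^ 4) as [Hd5 Hh4] by (split; apply pow_lt; easy).
  assert (0 < C) as HC by (unfold C; apply Rdiv_lt_0_compat; nra).
  replace (hK ^ 4 / (3000 * d ^ 5) * INR n) with (/ C) by (unfold C; field; lra).
  apply Rmult_le_reg_l with C; [easy|].
  rewrite <- Rmult_assoc, Rinv_r, Rmult_1_l by lra.
  destruct (Rlt_le_dec 0 Idp) as [Hp|Hp].
  (* The smallest admissible [lam]; the factors 6d then cancel. *)
  - set (lam := rpow (Idp / (6 * d)) (1 / q)).
    assert (0 < Idp / (6 * d)) as Hquot by (apply Rdiv_lt_0_compat; lra).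
    assert (rpow lam q = Idp / (6 * d)) as Elam
      by (unfold lam; apply rpow_inv'; lra).
    destruct (Hmain lam) as [_ HIpb].
    { apply rpow_gt0; easy. }
    { rewrite Elam; right; field; lra. }
    rewrite rpow_mult, Elam in HIpb by (try apply rpow_ge0; lra).
    apply Rle_trans with (rpow (Idp * rpow C q) (1 / q)).
    + apply rpow_le; [left; apply Rdiv_lt_0_compat; lra|].
      eapply Rle_trans; [exact HIpb|]; right; field; lra.
    + rewrite rpow_mult, rpow_inv by (try apply rpow_ge0; lra); lra.
  (* Every [lam] > 0 is admissible here. Taking [mu]/C with 6d [mu]^q = e gives [Ip] <= e for each e
     > 0, and [rpow] is 0 at nonpositive arguments. *)
  - assert (Ip <= 0) as HIp0.
    { apply Rle_plus_epsilon; intros e He.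
      set (mu := rpow (e / (6 * d)) (1 / q)).
      assert (0 < e / (6 * d)) as Hquot by (apply Rdiv_lt_0_compat; lra).
      assert (0 < mu) as Hmu by (apply rpow_gt0; easy).
      destruct (Hmain (mu / C)) as [_ HIpb].
      { apply Rdiv_lt_0_compat; easy. }
      { pose proof (rpow_ge0 (mu / C) q); nra. }
      replace (mu / C * C) with mu in HIpb by (field; lra).
      unfold mu in HIpb; rewrite rpow_inv' in HIpb by lra.
      replace (e / (6 * d) * (6 * d)) with e in HIpb by (field; lra); lra. }
    rewrite (rpow_nonpos Ip) by easy; nra.
Qed.
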